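(* Let $n$ be a positive multiple of $4$, let $c_e\ge 0$ and $0<c_l\le c_L$. Let $x^*=(x_1^*,\dots,x_n^* )\in\mathcal C^n$ and $f^*\in\mathcal{BL}[c_l,c_L,c_e]$, and suppose the observed random symmetric matrix $A\in\mathbb R^{n\times n}$ satisfies $A_{ii}=0$ and $A_{ij}=F_{ij}+E_{ij}$ for $1\le i<j\le n$, where $F$ is symmetric with $F_{ij}=f^*(x_i^*,x_j^* )$ for $i<j$, and the centered independent variables $(E_{ij})_{i<j}$ satisfy the subGaussian(1) condition. Let $\hat x\in\mathcal C^n$ be the output of the Localize-and-Refine procedure applied to $A$ (which does not use $c_l,c_L,c_e$). Then there exists a constant $C_{lLe}>0$ depending only on $c_e,c_l,c_L$ such that, with probability at least $1-5/n^2$, there exists a representation $(x,f)\in\mathcal R_{\Pi_n}[F,c_l,c_L,c_e]$ with $$d_\infty(\hat x,x)\le C_{lLe}\left(\min_{(x',f')\in\mathcal R[F,c_l,c_L,c_e]}d_\infty(x',\Pi_n)+\sqrt{\frac{\log n}{n}}\right).$$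
   Context: Geometry. $\mathcal C$ is the unit circle in $\mathbb R^2$, identified with unit complex numbers; $x\in\mathcal C$ has argument $\underline x\in[0,2\pi)$; $d(x,y)=|\underline x-\underline y|\wedge(2\pi-|\underline x-\underline y|)$ is the geodesic distance. For tuples $x,y$ of points of $\mathcal C$ indexed by the same set, $d_\infty(x,y)=\max_i d(x_i,y_i)$. For $k\ge1$: $\mathcal C_k=\{e^{\iota 2\pi j/k}:0\le j\le k-1\}$, and $\Pi_k$ is the set of $k$-tuples $(e^{\iota2\pi\sigma(j)/k})_{1\le j\le k}$, $\sigma$ a permutation of $\{1,\dots,k\}$ (similarly for tuples indexed by a set of cardinality $k$). $d_\infty(x,\Pi_k)=\min_{y\in\Pi_k}d_\infty(x,y)$. $\mathcal O$ is the orthogonal group of $\mathbb R^2$, and $Qx=(Qx_1,\dots,Qx_n)$. Bi-Lipschitz class. $\mathcal{BL}[c_l,c_L,c_e]$ is the set of symmetric functions $f:\mathcal C\times\mathcal C\to[0,1]$ such that for all $x,y,y'\in\mathcal C$, with $\varepsilon_n=c_e\sqrt{\log(n)/n}$: $|f(x,y)-f(x,y')|\le c_Ld(y,y')+\varepsilon_n$; and $f(x,y')-f(x,y)\ge c_l(d(x,y)-d(x,y'))-\varepsilon_n$ whenever $d(x,y)\ge d(x,y')$. Representations. $\mathcal R[F,c_l,c_L,c_e]=\{(x,f)\in\mathcal C^n\times\mathcal{BL}[c_l,c_L,c_e]: f(x_i,x_j)=F_{ij}\ \forall i<j\}$, and $\mathcal R_{\Pi_n}[F,c_l,c_L,c_e]$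 is the set of $(x,f)\in\mathcal R[F,c_l,c_L,c_e]$ minimizing $d_\infty(x,\Pi_n)$ over $\mathcal R[F,c_l,c_L,c_e]$. SubGaussian(1) condition: for every $B\in\mathbb R^{n\times n}$ and $t\ge0$, $\mathbb P\big[\sum_{i<j}B_{ij}E_{ij}>t\sqrt{\sum_{i<j}B_{ij}^2}\big]\le e^{-t^2/2}$. Localize-and-Refine procedure. Let $n_0=n/4$. For index sets, $A_{SS'}=[A_{ij}]_{i\in S,j\in S'}$, $\bar S=\{1,\dots,n\}\setminus S$; $\langle\cdot,\cdot\rangle$ is the entrywise (Frobenius) scalar product; $D(x_S)=[d(x_i,x_j)]_{i,j\in S}$, $D(z,x_S)=[d(z,x_j)]_{j\in S}$. Ties in argmins are broken arbitrarily (measurably). (A) Draw $S\subset\{1,\dots,n\}$, $|S|=n_0$, uniformly at random (independently of $A$). Compute $\hat x^{(1)}_S\in\arg\min_{x_S\in\Pi_{n_0}}\langle A_{SS},D(x_S)\rangle$, and for each $i\in\bar S$, $\hat x^{(2)}_i\in\arg\min_{z\in\mathcal C_{n_0}}\langle A_{i,S},D(z,\hat x^{(1)}_S)\rangle$. (B) Draw $S'\subset\bar S$, $|S'|=n_0$, uniformly at random. Compute $\hat x^{(1')}_{S'}\in\arg\min_{x_{S'}\in\Pi_{n_0}}\langle A_{S'S'},D(x_{S'})\rangle$ and for $i\in\bar S'$, $\hat x^{(2')}_i\in\arg\min_{z\in\mathcal C_{n_0}}\langle A_{i,S'},D(z,\hat x^{(1')}_{S'})\rangle$. (C) Compute $\hat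 Q\in\arg\min_{Q\in\mathcal O}d_\infty(\hat x^{(2)}_{\bar S\cap\bar S'},Q\hat x^{(2')}_{\bar S\cap\bar S'})$. Output $\hat x$ with $\hat x_j=\hat x^{(2)}_j$ for $j\in\bar S$ and $\hat x_j=\hat Q\hat x^{(2')}_j$ for $j\in S$.
   Formalization: The formal theorem assumes that the minimum of d_∞(x',Π_n) over R[F,c_l,c_L,c_e] is attained; it need not be (for some F with n=4 the infimum 0 is not reached), and then R_{Π_n} is empty and the claim fails. *)

(* Defs.v *)
From HB Require Import structures.
From mathcomp Require Import all_boot all_order all_algebra.
From mathcomp Require Import all_classical all_reals all_analysis.

Set Implicit Arguments.
Unset Strict Implicit.
Unset Printing Implicit Defensive.

Import Order.TTheory GRing.Theory Num.Theory.
Local Open Scope classical_set_scope.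
Local Open Scope ring_scope.

Definition argmin (R : realType) (X : Type) (D : set X) (obj : X -> R) : set X :=
  [set x | D x /\ forall y, D y -> obj x <= obj y].

(* The property "the minimum of A exists and equals m". *)
Definition is_min (R : realType) (A : set R) (m : R) : Prop :=
  A m /\ forall a, A a -> m <= a.

Section geometry.
Variable R : realType.

Definition circle : set 'cV[R]_2 := [set x | x 0 0 ^+ 2 + x 1 0 ^+ 2 = 1].

Definition expi (t : R) : 'cV[R]_2 :=
  \col_(k < 2) (if k == 0 then cos t else sin t).

(* The argument in [0, 2 pi); see ArgP. *)
Definition Arg (x : 'cV[R]_2) : R :=
  if 0 <= x 1 0 then acos (x 0 0) else 2 * pi - acos (x 0 0).

Lemma ArgP (x : 'cV[R]_2) :
  circle x -> 0 <= Arg x < 2 * pi /\ x = expi (Arg x).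
Proof.
rewrite /circle /= => h.
have sq0 : 0 <= x 0 0 ^+ 2 by exact: sqr_ge0.
have sq1 : 0 <= x 1 0 ^+ 2 by exact: sqr_ge0.
have a1 : -1 <= x 0 0 <= 1.
  by rewrite -ler_norml -(@expr_le1 _ 2) // real_normK ?num_real // -h lerDl.
have pi0 := pi_gt0 R.
have sE : sin (acos (x 0 0)) = `|x 1 0|.
  by rewrite sin_acos // -h addrAC subrr add0r sqrtr_sqr.
have cE : cos (acos (x 0 0)) = x 0 0 by apply: acosK; rewrite in_itv.
have expiE t : cos t = x 0 0 -> sin t = x 1 0 -> x = expi t.
  move=> ct st; apply/colP => k; rewrite mxE.
  case: (eqVneq k 0) => [->|k0]; first by rewrite ct.
  have -> : k = 1 by apply/val_inj; case: k k0 => -[|[]].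
  by rewrite st.
rewrite /Arg; case: (lerP 0 (x 1 0)) => hb; split.
- rewrite acos_ge0 //=; apply: le_lt_trans (acos_lepi a1) _.
  by rewrite mulr_natl mulr2n ltrDl.
- by apply: expiE; rewrite ?sE ?ger0_norm.
- have a_lt1 : x 0 0 < 1.
    have := a1 => /andP[_]; rewrite le_eqVlt => /orP[/eqP a1'|//].
    move: h; rewrite a1' expr1n => /eqP; rewrite -subr_eq0 addrAC subrr add0r.
    by rewrite sqrf_eq0 => /eqP h0; rewrite h0 ltxx in hb.
  have := acos_gt0 (x := x 0 0); have := a1 => /andP[-> _].
  rewrite a_lt1 => /(_ isT) p0.
  rewrite subr_ge0 gtrBl p0 andbT (le_trans (acos_lepi a1)) //.
  by rewrite mulr_natl mulr2n lerDl ltW.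
- apply: expiE; rewrite mulr_natl addrC.
    by rewrite cosD2pi cosN.
  by rewrite sinD2pi sinN sE ltr0_norm // opprK.
Qed.

Definition d (x y : 'cV[R]_2) : R :=
  Num.min `|Arg x - Arg y| (2 * pi - `|Arg x - Arg y|).

(* A tuple x_S indexed by S is represented by a total function on 'I_n of
   which only the values on S are used. *)
Definition dinf (n : nat) (S : {set 'I_n}) (x y : 'I_n -> 'cV[R]_2) : R :=
  \big[Num.max/0]_(i in S) d (x i) (y i).

Definition gridpt (k j : nat) : 'cV[R]_2 := expi (2 * pi * j%:R / k%:R).

Definition grid (k : nat) : set 'cV[R]_2 := [set gridpt k j | j in `I_k].

(* The tuples indexed by S that enumerate the grid of cardinality #|S|. *)
Definition Pi (n : nat) (S : {set 'I_n}) : set ('I_n -> 'cV[R]_2) :=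
  [set x | exists s : 'I_n -> nat,
    [/\ {in S, forall i, (s i < #|S|)%N},
        {in S &, injective s} &
        {in S, forall i, x i = gridpt #|S| (s i)}]].

(* The infimum is a minimum: Pi [set: 'I_n] is finite and nonempty. *)
Definition dPi (n : nat) (x : 'I_n -> 'cV[R]_2) : R :=
  inf [set dinf [set: 'I_n] x y | y in Pi [set: 'I_n]].

Definition orthogonal_group : set 'M[R]_2 := [set Q | Q *m Q^T = 1%:M].

End geometry.

Section representations.
Variables (R : realType) (n : nat).
Implicit Types (cl cL ce : R) (F : 'M[R]_n).

Definition rate : R := Num.sqrt (ln n%:R / n%:R).

(* A function on circle * circle is represented by a function on the plane
   about which nothing is required outside the circle. *)
Definition BL cl cL ce : set ('cV[R]_2 -> 'cV[R]_2 -> R) :=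
  [set f |
   [/\ forall x y, circle x -> circle y -> f x y = f y x,
       forall x y, circle x -> circle y -> 0 <= f x y <= 1,
       forall x y y', circle x -> circle y -> circle y' ->
         `|f x y - f x y'| <= cL * d y y' + ce * rate &
       forall x y y', circle x -> circle y -> circle y' ->
         d x y' <= d x y ->
         cl * (d x y - d x y') - ce * rate <= f x y' - f x y]].

Definition Reps F cl cL ce :
    set (('I_n -> 'cV[R]_2) * ('cV[R]_2 -> 'cV[R]_2 -> R)) :=
  [set xf |
   [/\ forall i, circle (xf.1 i),
       BL cl cL ce xf.2 &
       forall i j : 'I_n, (i < j)%N -> xf.2 (xf.1 i) (xf.1 j) = F i j]].

Definition RepsPi F cl cL ce :=
  argmin (Reps F cl cL ce) (fun xf => dPi xf.1).

End representations.

Section model.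
Context {disp : measure_display} {T : measurableType disp} {R : realType}.
Variables (P : probability T R) (n : nat).

Definition mutually_independent (I : finType) (D : {pred I})
    (X : I -> T -> R) : Prop :=
  forall (J : {set I}) (B : I -> set R),
    J \subset D -> (forall i, measurable (B i)) ->
    P [set w | forall i, i \in J -> B i (X i w)] =
    (\prod_(i in J) P (X i @^-1` B i))%E.

Definition subGaussian1 (E : 'I_n -> 'I_n -> T -> R) : Prop :=
  forall (B : 'M[R]_n) (t : R), 0 <= t ->
    (P [set w | (t * Num.sqrt (\sum_(i < n) \sum_(j < n | (i < j)%N) B i j ^+ 2)
        < \sum_(i < n) \sum_(j < n | (i < j)%N) B i j * E i j w)%R]
    <= (expR (- (t ^+ 2) / 2))%:E)%E.

(* The event that A i j lies in B i j for every (i, j) satisfying Q. *)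
Definition entries_in (A : T -> 'M[R]_n) (Q : rel 'I_n)
    (B : 'I_n -> 'I_n -> set R) : set T :=
  [set w | forall i j, Q i j -> B i j (A w i j)].

Definition measurable_tuple (x : T -> 'I_n -> 'cV[R]_2) : Prop :=
  forall i k, measurable_fun setT (fun w => x w i k 0).

(* First S is drawn uniformly among the n0-sets, independently of A, then S'
   uniformly among the n0-subsets of the complement of S; the boxes
   entries_in A _ B generate the sigma-algebra of A. *)
Definition uniform_draws (A : T -> 'M[R]_n) (n0 : nat)
    (S S' : T -> {set 'I_n}) : Prop :=
  [/\ forall s, measurable (S @^-1` [set s]),
      forall s, measurable (S' @^-1` [set s]),
      forall w, [/\ #|S w| = n0, #|S' w| = n0 & S' w \subset ~: S w] &
      forall (s s' : {set 'I_n}) (B : 'I_n -> 'I_n -> set R),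
        #|s| = n0 -> #|s'| = n0 -> s' \subset ~: s ->
        (forall i j, measurable (B i j)) ->
        P (entries_in A (fun _ _ => true) B
             `&` (S @^-1` [set s] `&` S' @^-1` [set s'])) =
        (P (entries_in A (fun _ _ => true) B) *
         ('C(n, n0)%:R^-1 * 'C(n - n0, n0)%:R^-1)%:E)%E].

(* The argmin x1 over Pi is computed from A_SS only: given S, its ties are
   broken by an arbitrary rule, possibly randomized, that does not look at the
   entries of A outside S * S. *)
Definition ties_from_block (A : T -> 'M[R]_n) (S : T -> {set 'I_n})
    (x1 : T -> 'I_n -> 'cV[R]_2) : Prop :=
  forall (s : {set 'I_n}) (v : 'I_n -> 'cV[R]_2) (B : 'I_n -> 'I_n -> set R),
    (forall i j, measurable (B i j)) ->
    let block := entries_in A (fun i j => (i \in s) && (j \in s)) B in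
    let rest := entries_in A (fun i j => ~~ ((i \in s) && (j \in s))) B in
    let draw := [set w | S w = s /\ {in s, x1 w =1 v}] in
    P (draw `&` block `&` rest) = (P (draw `&` block) * P rest)%E.

(* Stage (A), also used with S' as stage (B): x1 is meaningful on S and x2 on
   its complement. *)
Definition localize (A : T -> 'M[R]_n) (n0 : nat) (S : T -> {set 'I_n})
    (x1 x2 : T -> 'I_n -> 'cV[R]_2) : Prop :=
  [/\ measurable_tuple x1, measurable_tuple x2, ties_from_block A S x1,
      forall w, argmin (@Pi R n (S w))
        (fun x => \sum_(i in S w) \sum_(j in S w) A w i j * d (x i) (x j))
        (x1 w) &
      forall w i, i \notin S w -> argmin (@grid R n0)
        (fun z => \sum_(j in S w) A w i j * d z (x1 w j))
        (x2 w i)].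

Definition localize_and_refine (A : T -> 'M[R]_n)
    (xhat : T -> 'I_n -> 'cV[R]_2) : Prop :=
  let n0 := (n %/ 4)%N in
  exists (S S' : T -> {set 'I_n}) (x1 x2 x1' x2' : T -> 'I_n -> 'cV[R]_2)
         (Qhat : T -> 'M[R]_2),
    [/\ uniform_draws A n0 S S',
        localize A n0 S x1 x2 /\ localize A n0 S' x1' x2',
        forall k l, measurable_fun setT (fun w => Qhat w k l),
        forall w, argmin (@orthogonal_group R)
          (fun Q => dinf (~: S w :&: ~: S' w) (x2 w) (fun i => Q *m x2' w i))
          (Qhat w) &
        forall w j, xhat w j =
          if j \in S w then Qhat w *m x2' w j else x2 w j].

End model.

(* Main.v *)
(* Fix a representation (x, f) minimizing the distance m to Pi_n; it may replace
   the true one, since A depends on F only. Write rho = m + sqrt (log n / n) and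
   k = n / 4; when rho is not small the bound is trivial.

   A uniform k-subset S is balanced on every arc, so x_S is O(rho)-close to some
   z in Pi_S. Comparing the objective at the minimizer xhat with its value at z,
   a rearrangement inequality on each row and the lower Lipschitz condition give
   |D(xhat) - D(z)|_F <= C k rho. The grid is isotropic (its second moment matrix
   is k/2 times the identity), hence nearby Gram matrices force xhat ~ U z on
   average for an orthogonal U. The same rearrangement inequality applied to one
   row, together with isotropy, then bounds d(xhat_i, U x_i) by C rho for every i
   outside S. The two localizations agree up to an isometry on the n / 2 points
   outside S and S', which are isotropic too, so Qhat aligns them. Finally U is
   rounded to an isometry of the regular n-gon, which preserves the distance to
   Pi_n. *)

Require Import Defs.
From HB Require Import structures.
From mathcomp Require Import all_boot all_order all_algebra.
From mathcomp Require Import all_classical all_reals all_analysis.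
From mathcomp Require Import measurable_realfun.
From mathcomp Require Import zify ring lra.

Set Implicit Arguments.
Unset Strict Implicit.
Unset Printing Implicit Defensive.

Import Order.TTheory GRing.Theory Num.Theory.
Local Open Scope classical_set_scope.
Local Open Scope ring_scope.

(** * Distance, scalar product and isometries of the circle *)

(** On the grid, all rows D(z, x_S) with z a grid point have the same multiset of entries. The
    objective is linear in D, yet this gives it quadratic growth: sums of squares cancel in the
    comparison of two rows, so adding a multiple of the distance to the signal turns the lower
    Lipschitz condition into approximate monotonicity. Two noise bounds of different strength are
    needed. On a block, the deviation allowed is of order sqrt (n log n) times the Frobenius norm of
    the coefficients, enough for a union bound over all subsets and tuples. On a row it is only sqrt
    (log n), while the coefficients depend on the first localization; there it matters that the
    latter was computed from other entries of the matrix. The exceptional set is the union of five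
    events of probability at most 1/n^2: one for all blocks, serving both stages, and for each of
    the two draws one for the rows and one for the balance. Off this set the argument is
    deterministic. *)

Section geometry.
Import numFieldNormedType.Exports.
Variable R : realType.
Implicit Types (x y z : 'cV[R]_2) (a b t : R) (Q : 'M[R]_2).

Lemma norm_cosB_le a b : `|cos a - cos b| <= `|a - b|.
Proof.
wlog ab : a b / a <= b.
  by move=> H; case: (leP a b) => [|/ltW] /H //; rewrite distrC (distrC a).
move: ab; rewrite le_eqVlt => /orP[/eqP->|ab]; first by rewrite !subrr.
have cc : {within `[a, b], continuous (@cos R)}.
  by apply: continuous_subspaceT => u; exact: continuous_cos.
have [c _ E] := @MVT R cos (fun u => - sin u) a b ab
  (fun u _ => is_derive_cos u) cc.
rewrite distrC E normrM normrN (distrC a).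
by rewrite ler_piMl // sin_max.
Qed.

(** On [0, 1/2] the derivative of sine is at least 1/2; beyond, sine is increasing and t < 2, so sin
    (1/2) >= 1/4 > t / 8. *)
Lemma sin_ge t : 0 <= t <= pi / 2 -> t / 8 <= sin t.
Proof.
move=> /andP[t0 t2].
have p2 := pihalf_lt2 R; have p1 := pihalf_ge1 R.
have small (u : R) : 0 <= u <= 1/2 -> u / 2 <= sin u.
  move=> /andP[]; rewrite le_eqVlt => /orP[/eqP<-|u0 u2]; first by rewrite sin0 mul0r.
  have cs : {within `[0, u], continuous (@sin R)}.
    by apply: continuous_subspaceT => v; exact: continuous_sin.
  have [c] := @MVT R sin cos 0 u u0 (fun v _ => is_derive_sin v) cs.
  rewrite in_itv/= => /andP[c0 cu]; rewrite sin0 !subr0 => ->.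
  have := norm_cosB_le c 0; rewrite cos0 subr0 (gtr0_norm c0) ler_norml => /andP[h _].
  by rewrite mulrC ler_wpM2r; lra.
case: (leP t (1/2)) => ht; first by have := small t; lra.
have h12 : 0 <= (1/2 : R) <= 1/2 by lra.
have := small _ h12.
suff : sin (1/2) < sin t by lra.
by rewrite ltr_sin // ?in_itv /=; lra.
Qed.

Definition dot x y : R := x 0 0 * y 0 0 + x 1 0 * y 1 0.

Lemma dot_mx x y : dot x y = (x^T *m y) 0 0.
Proof.
rewrite !mxE big_ord_recl big_ord1 !mxE /dot.
by have -> : lift ord0 ord0 = 1 :> 'I_2 by apply/val_inj.
Qed.

Lemma dotC x y : dot x y = dot y x.
Proof. by rewrite /dot; ring. Qed.

Lemma dotBl x y z : dot (x - y) z = dot x z - dot y z.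
Proof. by rewrite /dot !mxE; ring. Qed.

Lemma dotBr x y z : dot x (y - z) = dot x y - dot x z.
Proof. by rewrite /dot !mxE; ring. Qed.

Lemma dot_ge0 x : 0 <= dot x x.
Proof. by rewrite /dot -!expr2 addr_ge0 ?sqr_ge0. Qed.

Lemma dot_sqr_le x y : dot x y ^+ 2 <= dot x x * dot y y.
Proof.
rewrite -subr_ge0 (_ : _ - _ = (x 0 0 * y 1 0 - x 1 0 * y 0 0) ^+ 2) ?sqr_ge0 //.
by rewrite /dot; ring.
Qed.

Lemma circleE x : circle x -> dot x x = 1.
Proof. by rewrite /circle /dot /= -!expr2. Qed.

Lemma circle_expi t : circle (expi t).
Proof. by rewrite /circle /= !mxE /= cos2Dsin2. Qed.

Lemma dot_expi a b : dot (expi a) (expi b) = cos (a - b).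
Proof. by rewrite /dot !mxE /= cosB. Qed.

Lemma expiD2pi t : expi (t + pi *+ 2) = expi t :> 'cV[R]_2.
Proof. by apply/colP => i; rewrite !mxE cosD2pi sinD2pi. Qed.

Lemma Arg_itv x : circle x -> 0 <= Arg x < 2 * pi.
Proof. by case/ArgP. Qed.

Lemma d_sym x y : d x y = d y x.
Proof. by rewrite /d distrC. Qed.

Lemma d_itv x y : circle x -> circle y -> 0 <= d x y <= pi.
Proof.
move=> /Arg_itv/andP[a0 a1] /Arg_itv/andP[b0 b1].
have : `|Arg x - Arg y| < 2 * pi by rewrite ltr_norml; lra.
rewrite /d; move: `|_| (normr_ge0 (Arg x - Arg y)) => u u0 u1.
by case: (leP u) => h; lra.
Qed.

Lemma cos_d x y : circle x -> circle y -> cos (d x y) = dot x y.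
Proof.
move=> cx cy; have [_ ex] := ArgP cx; have [_ ey] := ArgP cy.
rewrite {2}ex {2}ey dot_expi /d.
case: leP => _; first by rewrite cos_norm.
by rewrite -cosN opprB mulr_natl -(cosD2pi (_ - _)) subrK cos_norm.
Qed.

Lemma d_expi_le a b : d (expi a) (expi b) <= `|a - b|.
Proof.
have /andP[d0 dpi] := d_itv (circle_expi a) (circle_expi b).
case: (leP `|a - b| pi) => h; last exact: le_trans dpi (ltW h).
have E := cos_d (circle_expi a) (circle_expi b).
move: E; rewrite dot_expi -(cos_norm (a - b)) => /cos_inj -> //; rewrite in_itv /=.
  by rewrite d0.
by rewrite normr_ge0.
Qed.

(** Lifts a pair to real angles whose difference realizes the distance, the angle of [x] being
    prescribed. Two lifts sharing their middle angle reduce the triangle inequality on the circle to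
    that of the reals. *)
Lemma d_lift b x y : circle x -> circle y -> x = expi b ->
  exists2 c, y = expi c & `|b - c| = d x y.
Proof.
move=> cx cy xb.
suff [a [c [xa yc E]]] : exists a c, [/\ x = expi a, y = expi c & `|a - c| = d x y].
  (* The two angles of [x] differ by a full number of turns, which is only seen through sine and
     cosine; the angle of [y] can be shifted by [b - a]. *)
  have cab : cos (b - a) = 1 by rewrite -dot_expi -xa -xb circleE.
  have sab : sin (b - a) = 0.
    by have := cos2Dsin2 (b - a); rewrite cab expr1n => /eqP; rewrite -subr_eq0 addrAC subrr add0r sqrf_eq0 => /eqP.
  exists (c + (b - a)); last by rewrite -E; congr `|_|; ring.
  by rewrite yc; apply/colP => i; rewrite !mxE cosD cab sab sinD cab sab !mulr0 !mulr1 subr0 addr0.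
have [/andP[a0 a1] ex] := ArgP cx; have [/andP[b0 b1] ey] := ArgP cy.
rewrite /d; case: leP => h; first by exists (Arg x), (Arg y).
move: (Arg x) (Arg y) ex ey a0 a1 b0 b1 h => a c xa yc a0 a1 c0 c1 h.
case: (leP a c) h => ac; [rewrite ler0_norm|rewrite gtr0_norm]; rewrite ?subr_le0 ?subr_gt0 // => h.
- exists (a + pi *+ 2), c; rewrite expiD2pi; split => //.
  by rewrite ger0_norm; rewrite -mulr_natl; lra.
- exists a, (c + pi *+ 2); rewrite expiD2pi; split => //.
  by rewrite ler0_norm; rewrite -mulr_natl; lra.
Qed.

Lemma d_triangle y x z : circle x -> circle y -> circle z ->
  d x z <= d x y + d y z.
Proof.
move=> cx cy cz; have [_ yb] := ArgP cy.
rewrite (d_sym x y).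
have [a xa <-] := d_lift cy cx yb; have [c zc <-] := d_lift cy cz yb.
rewrite xa zc (le_trans (d_expi_le _ _)) //.
have -> : a - c = (a - Arg y) + (Arg y - c) by ring.
by rewrite (distrC (Arg y) a); exact: ler_normD.
Qed.

Lemma dxx x : circle x -> d x x = 0.
Proof.
move=> cx; rewrite /d subrr normr0 subr0; apply/min_idPl.
by rewrite mulr_ge0 // pi_ge0.
Qed.

Lemma normB_d_le x y z : circle x -> circle y -> circle z ->
  `|d x z - d y z| <= d x y.
Proof.
move=> cx cy cz; rewrite ler_norml lerBrDr lerBlDr.
have := d_triangle cx cy cz; have := d_triangle cy cx cz.
by rewrite (d_sym y x); lra.
Qed.

Lemma dot_sub x y : circle x -> circle y ->
  dot (x - y) (x - y) = 2 * (1 - cos (d x y)).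
Proof.
move=> cx cy; rewrite cos_d // dotBl !dotBr (dotC y x) (circleE cx) (circleE cy).
by ring.
Qed.

Lemma oneBcos t : 1 - cos t = 2 * sin (t / 2) ^+ 2.
Proof.
rewrite {1}(_ : t = (t / 2) *+ 2); last by rewrite -mulr_natl; lra.
by rewrite cos_mulr2n cos2sin2 !mulr2n; ring.
Qed.

Lemma dot_sub_le x y : circle x -> circle y ->
  dot (x - y) (x - y) <= d x y ^+ 2.
Proof.
move=> cx cy; rewrite dot_sub //.
rewrite oneBcos; have := norm_cosB_le (d x y / 2 - pi / 2) (- (pi / 2)).
rewrite cosBpihalf cosN cos_pihalf subr0 opprK subrK.
have /andP[d0 _] := d_itv cx cy.
rewrite (ger0_norm (_ : 0 <= d x y / 2)); last by rewrite divr_ge0.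
move=> h; have : `|sin (d x y / 2)| ^+ 2 <= (d x y / 2) ^+ 2.
  by rewrite lerXn2r // nnegrE ?divr_ge0.
by rewrite real_normK ?num_real //; lra.
Qed.

(** The chord is twice the sine of half the arc, so [sin_ge] at half the arc costs the factor
    8^2. *)
Lemma d_sq_le x y : circle x -> circle y ->
  d x y ^+ 2 <= 64 * dot (x - y) (x - y).
Proof.
move=> cx cy; rewrite dot_sub //.
rewrite oneBcos; have /andP[d0 d1] := d_itv cx cy.
have h0 : 0 <= d x y / 2 <= pi / 2 by lra.
have h := sin_ge h0.
have : (d x y / 2 / 8) ^+ 2 <= sin (d x y / 2) ^+ 2.
  by rewrite lerXn2r // nnegrE; lra.
by lra.
Qed.

Lemma norm_dotB_le x y z : circle x -> circle y -> circle z ->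
  `|dot x z - dot y z| <= `|d x z - d y z|.
Proof. by move=> cx cy cz; rewrite -!cos_d // norm_cosB_le. Qed.

Lemma ortho_trmx Q : orthogonal_group Q -> orthogonal_group Q^T.
Proof. by rewrite /orthogonal_group /= trmxK => /mulmx1C. Qed.

Lemma ortho_mul Q Q' : orthogonal_group Q -> orthogonal_group Q' ->
  orthogonal_group (Q *m Q').
Proof.
rewrite /orthogonal_group /= => h h'.
by rewrite trmx_mul mulmxA -(mulmxA Q) h' mulmx1.
Qed.

Lemma dot_ortho Q x y : orthogonal_group Q -> dot (Q *m x) (Q *m y) = dot x y.
Proof.
move=> /ortho_trmx; rewrite /orthogonal_group /= trmxK => h.
by rewrite !dot_mx trmx_mul mulmxA -(mulmxA x^T) h mulmx1.
Qed.

Lemma circle_dot x : circle x <-> dot x x = 1.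
Proof. by rewrite /circle /dot /= -!expr2. Qed.

Lemma circle_ortho Q x : orthogonal_group Q -> circle x -> circle (Q *m x).
Proof. by move=> oQ /circle_dot cx; apply/circle_dot; rewrite dot_ortho. Qed.

Lemma d_ortho Q x y : orthogonal_group Q -> circle x -> circle y ->
  d (Q *m x) (Q *m y) = d x y.
Proof.
move=> oQ cx cy; apply: (@cos_inj R); rewrite ?in_itv /=; try exact: d_itv.
  by apply: d_itv; exact: circle_ortho.
by rewrite !cos_d ?dot_ortho //; exact: circle_ortho.
Qed.

Lemma ortho_trK Q x : orthogonal_group Q -> Q *m (Q^T *m x) = x.
Proof. by move=> h; rewrite mulmxA h mul1mx. Qed.

Lemma ortho_Ktr Q x : orthogonal_group Q -> Q^T *m (Q *m x) = x.
Proof. by move=> /ortho_trmx/ortho_trK; rewrite trmxK => ->. Qed.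

End geometry.

(** * The regular grid *)

Section grid.
Variable R : realType.
Implicit Types (x y z : 'cV[R]_2) (t : R).

Lemma Arg_expi t : 0 <= t < 2 * pi -> Arg (expi t) = t.
Proof.
move=> /andP[t0 t1]; rewrite /Arg !mxE /=.
case: (leP t pi) => h.
  by rewrite sin_ge0_pi ?t0 // cosK // in_itv /= t0.
have h0 : 0 < 2 * pi - t < pi by lra.
have := sin_gt0_pi h0; rewrite mulr_natl addrC sinD2pi sinN => s0.
rewrite (_ : 0 <= sin t = false); last by apply/negbTE; rewrite -ltNge; lra.
rewrite -(cosN t) -(cosD2pi (- t)) cosK; last by rewrite in_itv /= -mulr_natl; lra.
by rewrite -mulr_natl; lra.
Qed.

Lemma circle_gridpt k j : circle (gridpt R k j).
Proof. exact: circle_expi. Qed.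

Lemma grid_angle_itv k j : (j < k)%N -> 0 <= (2 * pi * j%:R / k%:R : R) < 2 * pi.
Proof.
move=> jk; have k0 : 0 < k%:R :> R by rewrite ltr0n; lia.
have p0 := pi_gt0 R.
rewrite divr_ge0 ?mulr_ge0 ?(ltW p0) //=.
by rewrite ltr_pdivrMr // ltr_pM2l ?ltr_nat //; lra.
Qed.

Lemma Arg_gridpt k j : (j < k)%N -> Arg (gridpt R k j) = 2 * pi * j%:R / k%:R.
Proof. by move=> jk; rewrite Arg_expi // grid_angle_itv. Qed.

Lemma gridpt_inj k i j : (i < k)%N -> (j < k)%N -> gridpt R k i = gridpt R k j -> i = j.
Proof.
move=> ik jk /(congr1 (@Arg R)); rewrite !Arg_gridpt //.
have k0 : k%:R != 0 :> R by rewrite pnatr_eq0; lia.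
have p0 : 2 * pi != 0 :> R by rewrite mulf_neq0 // gt_eqF // pi_gt0.
by move/(mulIf (invr_neq0 k0))/(mulfI p0)/eqP; rewrite eqr_nat => /eqP.
Qed.

(** The cyclic distance modulo [k]. One of the two truncated differences vanishes, so their sum is
    the absolute difference. *)
Definition ndist k a b : nat := minn (a - b + (b - a)) (k - (a - b + (b - a))).

Lemma d_gridpt k a b : (a < k)%N -> (b < k)%N ->
  d (gridpt R k a) (gridpt R k b) = 2 * pi / k%:R * (ndist k a b)%:R.
Proof.
move=> ak bk; rewrite /d !Arg_gridpt //.
have k0 : 0 < k%:R :> R by rewrite ltr0n; lia.
have c0 : 0 < 2 * pi / k%:R :> R by rewrite divr_gt0 // mulr_gt0 // pi_gt0.
have -> : 2 * pi * a%:R / k%:R - 2 * pi * b%:R / k%:R = (2 * pi / k%:R) * (a%:R - b%:R) :> R.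
  by field; rewrite gt_eqF.
rewrite normrM (gtr0_norm c0).
have -> : `|a%:R - b%:R| = (a - b + (b - a))%N%:R :> R.
  case: (leqP a b) => ab.
    by rewrite ler0_norm ?subr_le0 ?ler_nat // opprB -natrB //; congr _%:R; lia.
  by rewrite gtr0_norm ?subr_gt0 ?ltr_nat // -natrB 1?ltnW //; congr _%:R; lia.
rewrite /ndist; set e := (a - b + (b - a))%N.
have ek : (e <= k)%N by rewrite /e; lia.
have -> : 2 * pi - 2 * pi / k%:R * e%:R = 2 * pi / k%:R * (k - e)%N%:R :> R.
  by rewrite natrB //; field; rewrite gt_eqF.
rewrite -minr_pMr ?(ltW c0) //; congr (_ * _).
by case: (leqP e (k - e)) => h; case: leP => //; rewrite ?ltr_nat ?ler_nat; lia.
Qed.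

(** Cutting the sum at the base point and swapping the two pieces gives the profile min(r, k - r),
    the same for every base point. This makes all rows of distances on the grid rearrangements of
    each other. *)
Lemma sum_ndist (V : nmodType) (phi : nat -> V) k a b : (a < k)%N -> (b < k)%N ->
  \sum_(0 <= j < k) phi (ndist k a j) = \sum_(0 <= j < k) phi (ndist k b j).
Proof.
move=> ak bk.
suff H c : (c < k)%N ->
    \sum_(0 <= j < k) phi (ndist k c j) = \sum_(0 <= r < k) phi (minn r (k - r)).
  by rewrite !H.
move=> ck; rewrite (@big_cat_nat _ _ _ c) //=; last exact: ltnW.
rewrite [RHS](@big_cat_nat _ _ _ (k - c)) //=; last exact: leq_subr.
rewrite addrC; congr (_ + _).
  rewrite -{1}(add0n c) big_addn; apply: eq_bigr => r _; congr phi.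
  by rewrite /ndist; lia.
rewrite -{1}(add0n (k - c)%N) big_addn (_ : k - (k - c) = c)%N; last by lia.
rewrite !big_nat; apply: eq_bigr => r /andP[_ rc]; congr phi.
by rewrite /ndist; lia.
Qed.

Lemma sum_shift_periodic (V : zmodType) (phi : nat -> V) k : phi k = phi 0%N ->
  \sum_(j < k) phi j.+1 = \sum_(j < k) phi j.
Proof.
move=> h; apply: (addrI (phi 0%N)); rewrite -(big_ord_recl k (fun i : 'I_k.+1 => phi i)).
by rewrite big_ord_recr /= h addrC.
Qed.

(** A shift of the index rotates the vector (C, S) by 4 pi / k without changing it. For k > 2 this
    is not a full number of turns, so the vector is zero. *)
Lemma sum_cos_sin_grid k : (2 < k)%N ->
  (\sum_(j < k) cos (2 * (2 * pi * j%:R / k%:R)) = 0 :> R) /\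
  (\sum_(j < k) sin (2 * (2 * pi * j%:R / k%:R)) = 0 :> R).
Proof.
move=> k2; set th := fun j : nat => 2 * (2 * pi * j%:R / k%:R) : R.
have k0 : 0 < k%:R :> R by rewrite ltr0n; lia.
have p0 := pi_gt0 R.
set C := \sum_(j < k) _; set S := \sum_(j < k) _.
pose al := 2 * (2 * pi / k%:R) : R.
have thS j : th j.+1 = th j + al.
  by rewrite /th /al -natr1; field; rewrite gt_eqF.
have thk : th k = th 0%N + pi *+ 2 + pi *+ 2.
  by rewrite /th !mulr2n; field; rewrite gt_eqF.
have eC : C = C * cos al - S * sin al.
  rewrite {1}/C -(@sum_shift_periodic _ (fun j => cos (th j))); last by rewrite thk !cosD2pi.
  by rewrite /C /S !mulr_suml -sumrB; apply: eq_bigr => j _; rewrite thS cosD.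
have eS : S = S * cos al + C * sin al.
  rewrite {1}/S -(@sum_shift_periodic _ (fun j => sin (th j))); last by rewrite thk !sinD2pi.
  by rewrite /C /S !mulr_suml -big_split; apply: eq_bigr => j _; rewrite thS sinD.
have h : (C ^+ 2 + S ^+ 2) * (1 - cos al) = 0.
  have h1 : C * C = C * (C * cos al - S * sin al) by rewrite -eC.
  have h2 : S * S = S * (S * cos al + C * sin al) by rewrite -eS.
  lra.
have ca : 1 - cos al != 0.
  rewrite oneBcos mulf_neq0 // sqrf_eq0 gt_eqF // sin_gt0_pi //.
  have -> : al / 2 = 2 * pi / k%:R :> R by rewrite /al; field; rewrite gt_eqF.
  rewrite divr_gt0 ?mulr_gt0 //= ltr_pdivrMr // mulrC ltr_pM2l //.
  by rewrite (ltr_nat R 2).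
have : C ^+ 2 + S ^+ 2 = 0 by move/eqP: h; rewrite mulf_eq0 (negbTE ca) orbF => /eqP.
move/eqP; rewrite paddr_eq0 ?sqr_ge0 // !sqrf_eq0 => /andP[/eqP-> /eqP->].
by [].
Qed.

(** Isotropy of the grid: each product is half of [dot z z'] plus terms in the doubled angle, which
    cancel over the grid. *)
Lemma sum_dot_grid k z z' : (2 < k)%N ->
  \sum_(0 <= j < k) dot z (gridpt R k j) * dot z' (gridpt R k j) = k%:R / 2 * dot z z'.
Proof.
move=> k2; have [hC hS] := sum_cos_sin_grid k2.
rewrite big_mkord.
have E (j : 'I_k) : dot z (gridpt R k j) * dot z' (gridpt R k j) =
  dot z z' / 2
  + (z 0 0 * z' 0 0 - z 1 0 * z' 1 0) / 2 * cos (2 * (2 * pi * j%:R / k%:R))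
  + (z 0 0 * z' 1 0 + z 1 0 * z' 0 0) / 2 * sin (2 * (2 * pi * j%:R / k%:R)).
  rewrite /dot /gridpt !mxE /=; set t := 2 * pi * _ / _.
  rewrite !(mulr_natl t 2) sin_mulr2n cos_mulr2n !mulr2n.
  have := cos2Dsin2 t => h.
  have s2 : sin t ^+ 2 = 1 - cos t ^+ 2 by lra.
  apply/eqP; rewrite -subr_eq0; apply/eqP.
  transitivity (z 1 0 * z' 1 0 * (sin t ^+ 2 - (1 - cos t ^+ 2))); first by field.
  by rewrite s2 subrr mulr0.
rewrite (eq_bigr _ (fun j _ => E j)) !big_split /= -!mulr_sumr hC hS.
by rewrite sumr_const card_ord -mulr_natl; ring.
Qed.

Lemma near_grid k y : (0 < k)%N -> circle y ->
  exists2 a, (a < k)%N & d (gridpt R k a) y <= 2 * pi / k%:R.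
Proof.
move=> k0 cy; have [/andP[a0 a1] ->] := ArgP cy.
have p0 := pi_gt0 R; have kR : 0 < k%:R :> R by rewrite ltr0n.
set t := Arg y in a0 a1 *.
have u0 : 0 <= t * k%:R / (2 * pi) by rewrite divr_ge0 ?mulr_ge0 // ltW.
have /andP[] := truncn_itv u0; set a := Num.truncn _ => h1 h2.
have ha : a%:R * (2 * pi) <= t * k%:R by move: h1; rewrite ler_pdivlMr // mulr_gt0.
exists a.
  rewrite -(ltr_nat R) (le_lt_trans h1) // ltr_pdivrMr ?mulr_gt0 // mulrC.
  by rewrite ltr_pM2l.
apply: le_trans (d_expi_le _ _) _.
have h3 : t * k%:R < a.+1%:R * (2 * pi) by move: h2; rewrite ltr_pdivrMr // mulr_gt0.
rewrite distrC ger0_norm ?subr_ge0; last first.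
  by rewrite ler_pdivrMr // mulrC.
rewrite lerBlDr -mulrDl ler_pdivlMr //.
by move: h3; rewrite -natr1; lra.
Qed.

End grid.

Lemma sum_inj_card (n : nat) (V : nmodType) (phi : nat -> V) (S : {set 'I_n}) (s : 'I_n -> nat) :
  {in S, forall i, (s i < #|S|)%N} -> {in S &, injective s} ->
  \sum_(i in S) phi (s i) = \sum_(0 <= j < #|S|) phi j.
Proof.
move=> sS sI; rewrite -big_enum /= -(big_map s xpredT phi).
apply: perm_big; rewrite /index_iota subn0.
have u : uniq (map s (enum S)).
  by rewrite map_inj_in_uniq ?enum_uniq // => i j; rewrite !mem_enum; exact: sI.
apply: uniq_perm => //; first exact: iota_uniq.
have sub : {subset map s (enum S) <= iota 0 #|S|}.
  by move=> j /mapP[i]; rewrite mem_enum => /sS h ->; rewrite mem_iota.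
have [] := uniq_min_size u sub; first by rewrite size_iota size_map -cardE.
by [].
Qed.

(** * Rearrangement *)

Section rearrangement.
Variables (R : realType) (I : finType) (S : {set I}).

(** Cauchy-Schwarz against the constant 1, read off the nonnegative variance of the absolute
    values. *)
Lemma sqr_sum_norm_le (a : I -> R) :
  (\sum_(i in S) `|a i|) ^+ 2 <= #|S|%:R * \sum_(i in S) a i ^+ 2.
Proof.
set T := \sum_(i in S) _; set Q := \sum_(i in S) _; set m : R := #|S|%:R.
have [S0|S0] := eqVneq #|S| 0%N.
  move/eqP: S0; rewrite cards_eq0 => /eqP S0.
  by rewrite /T /Q S0 !big_set0 expr0n mulr0.
have m0 : 0 < m by rewrite ltr0n lt0n.
rewrite -subr_ge0 -(pmulr_rge0 _ m0).
suff <- : \sum_(i in S) (m * `|a i| - T) ^+ 2 = m * (m * Q - T ^+ 2).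
  by apply: sumr_ge0 => i _; exact: sqr_ge0.
have E i : i \in S -> (m * `|a i| - T) ^+ 2 = m ^+ 2 * a i ^+ 2 - 2 * m * T * `|a i| + T ^+ 2.
  move=> _; rewrite -[a i ^+ 2]real_normK ?num_real //; ring.
rewrite (eq_bigr _ E) !big_split /= sumrN -!mulr_sumr -/Q -/T sumr_const -mulr_natl -/m.
by ring.
Qed.

Variables (X Y : I -> nat).
(** The values of [X] and [Y] on [S] agree with multiplicities; test functions avoid naming a
    permutation. *)
Hypothesis XY : forall phi : nat -> R, \sum_(j in S) phi (X j) = \sum_(j in S) phi (Y j).

(* Layer cake: [Y j - X j] is the sum over t of [layer t j], and each layer
   compares two sets of the same cardinality. *)
Let layer t j : R := (t < Y j)%N%:R - (t < X j)%N%:R.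

Let natr_layer M m : (m <= M)%N -> m%:R = \sum_(t < M) (t < m)%N%:R :> R.
Proof.
move=> mM; rewrite -natr_sum; congr _%:R.
rewrite -(big_mkord xpredT (fun t => nat_of_bool (t < m)%N)) (@big_cat_nat _ _ _ m) //=.
rewrite big_nat (eq_bigr (fun=> 1%N)); last by move=> i /andP[_ ->].
rewrite -big_nat sum_nat_const_nat subn0 muln1 big_nat big1 ?addn0 //.
by move=> i /andP[mi _]; rewrite ltnNge mi.
Qed.

Variables (g : I -> R) (e : R).
Hypothesis e0 : 0 <= e.
Hypothesis gX : {in S &, forall j j', (X j' <= X j)%N -> g j - e <= g j'}.

(** Since the layer sums to zero, [g] may be recentred at its maximum over the set where t < X.
    Points of that set missing from t < Y then contribute nonnegatively, and new points have a
    smaller [X], hence lose at most [e] by [gX]. *)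
Let rearrangement_layer t :
  - e * \sum_(j in S) `|layer t j| <= \sum_(j in S) g j * layer t j.
Proof.
have layer0 : \sum_(j in S) layer t j = 0.
  by rewrite /layer sumrB -(XY (fun m => (t < m)%N%:R)) subrr.
have [[j0 /andP[j0S j0t]]|none] := pselect (exists j, (j \in S) && (t < X j)%N).
  have P0 : (j0 \in S) && (t < X j0)%N by rewrite j0S.
  have := @arg_maxP _ R I j0 (fun j => (j \in S) && (t < X j)%N) g P0.
  case=> jm /andP[jmS jmt] jmax.
  have -> : \sum_(j in S) g j * layer t j = \sum_(j in S) (g j - g jm) * layer t j.
    under [RHS]eq_bigr do rewrite mulrBl.
    by rewrite sumrB -mulr_sumr layer0 mulr0 subr0.
  rewrite mulr_sumr; apply: ler_sum => j jS; rewrite /layer.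
  case: (ltnP t (X j)) => hX; case: (ltnP t (Y j)) => hY /=;
    rewrite ?subrr ?normr0 ?mulr0 // ?subr0 ?sub0r ?normrN normr1 ?mulr1 //.
    have : g j <= g jm by apply: jmax; rewrite jS.
    by move: e0 => e0' h; rewrite mulrN1; lra.
  have := gX jmS jS (leq_trans hX (ltnW jmt)).
  by move=> h; lra.
(* If t < X holds nowhere, then by [XY] neither does t < Y, and the layer vanishes. *)
have Xt j : j \in S -> (t < X j)%N = false.
  by move=> jS; apply/negP => h; apply: none; exists j; rewrite jS.
have Yt j : j \in S -> (t < Y j)%N%:R = 0 :> R.
  move: j; apply: psumr_eq0P; first by move=> *; rewrite ler0n.
  by rewrite -(XY (fun m => (t < m)%N%:R)) big1 // => i /Xt ->.
rewrite !big1 ?mulr0 // => j jS; by rewrite /layer Yt // Xt // subrr ?normr0 ?mulr0.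
Qed.

Lemma rearrangement :
  - e * \sum_(j in S) `|(Y j)%:R - (X j)%:R| <=
  \sum_(j in S) g j * ((Y j)%:R - (X j)%:R).
Proof.
pose M := (\sum_j (X j + Y j))%N.
have XM j : (X j <= M)%N by rewrite /M (bigD1 j) //=; lia.
have YM j : (Y j <= M)%N by rewrite /M (bigD1 j) //=; lia.
have E j : (Y j)%:R - (X j)%:R = \sum_(t < M) layer t j.
  by rewrite (natr_layer (XM j)) (natr_layer (YM j)) sumrB.
(* At a fixed [j] all layers have the sign of Y - X, so their absolute values add up without
   loss. *)
have En j : `|(Y j)%:R - (X j)%:R| = \sum_(t < M) `|layer t j|.
  rewrite E; case: (leqP (X j) (Y j)) => h.
    rewrite ger0_norm; last first.
      apply: sumr_ge0 => t _; rewrite subr_ge0 ler_nat.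
      by case: (ltnP t (X j)) => // h'; rewrite (leq_trans h' h).
    apply: eq_bigr => t _; rewrite ger0_norm // subr_ge0 ler_nat.
    by case: (ltnP t (X j)) => // h'; rewrite (leq_trans h' h).
  rewrite ler0_norm; last first.
    apply: sumr_le0 => t _; rewrite subr_le0 ler_nat.
    by case: (ltnP t (Y j)) => // h'; rewrite (ltn_trans h' h).
  rewrite -sumrN; apply: eq_bigr => t _; rewrite ler0_norm // subr_le0 ler_nat.
  by case: (ltnP t (Y j)) => // h'; rewrite (ltn_trans h' h).
rewrite (eq_bigr _ (fun j _ => En j)) (eq_bigr _ (fun j _ => congr1 (fun u => g j * u) (E j))).
under [X in _ <= X]eq_bigr do rewrite mulr_sumr.
rewrite exchange_big [X in _ <= X]exchange_big mulr_sumr /=.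
by apply: ler_sum => t _; exact: rearrangement_layer.
Qed.

End rearrangement.

(** The hypothesis on [F] says that F + c w X decreases in [X] up to [e], so [rearrangement] applies
    to it. As [X] and [Y] have equal sums of squares, the sum of X (Y - X) is minus half the sum of
    (Y - X)^2, which is the quadratic gain. *)
Lemma signal_lower_bound (R : realType) (I : finType) (S : {set I}) (X Y : I -> nat)
    (F : I -> R) (w c e : R) :
  0 <= w -> 0 <= e ->
  (forall phi : nat -> R, \sum_(j in S) phi (X j) = \sum_(j in S) phi (Y j)) ->
  {in S &, forall j j', (X j' <= X j)%N ->
     c * (w * (X j)%:R - w * (X j')%:R) - e <= F j' - F j} ->
  c / 2 * (\sum_(j in S) (w * (Y j)%:R - w * (X j)%:R) ^+ 2)
    - e * (\sum_(j in S) `|w * (Y j)%:R - w * (X j)%:R|)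
  <= \sum_(j in S) F j * (w * (Y j)%:R - w * (X j)%:R).
Proof.
move=> w0 e0 XY FX.
pose g j := F j + c * (w * (X j)%:R).
have gX : {in S &, forall j j', (X j' <= X j)%N -> g j - e <= g j'}.
  by move=> j j' jS jS' /(FX _ _ jS jS'); rewrite /g; lra.
have := ler_wpM2l w0 (rearrangement XY e0 gX).
have -> : w * (- e * \sum_(j in S) `|(Y j)%:R - (X j)%:R|) =
   - e * (\sum_(j in S) `|w * (Y j)%:R - w * (X j)%:R|).
  rewrite mulrCA mulr_sumr; congr (_ * _); apply: eq_bigr => j _.
  by rewrite -mulrBr normrM (ger0_norm w0).
rewrite [X in _ <= X]mulr_sumr => h.
have sq := XY (fun m => (w * m%:R) ^+ 2).
suff <- : \sum_(j in S) w * (g j * ((Y j)%:R - (X j)%:R)) + c / 2 * (\sum_(j in S) (w * (Y j)%:R - w * (X j)%:R) ^+ 2) = \sum_(j in S) F j * (w * (Y j)%:R - w * (X j)%:R) by lra.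
have -> : \sum_(j in S) F j * (w * (Y j)%:R - w * (X j)%:R) =
  \sum_(j in S) F j * (w * (Y j)%:R - w * (X j)%:R) + c / 2 *
    (\sum_(j in S) (w * (Y j)%:R) ^+ 2 - \sum_(j in S) (w * (X j)%:R) ^+ 2).
  by rewrite sq subrr mulr0 addr0.
rewrite -sumrB !mulr_sumr -!big_split; apply: eq_bigr => j _.
by rewrite /g /=; field.
Qed.

(** * Quadratic growth of the objective in one row *)

Section signal.
Variables (R : realType) (n : nat).
Implicit Types (S : {set 'I_n}) (x : 'I_n -> 'cV[R]_2) (z : 'cV[R]_2).

Lemma circle_Pi S x i : Pi S x -> i \in S -> circle (x i).
Proof. by case=> s [_ _ h] /h ->; exact: circle_gridpt. Qed.

Lemma circle_grid k z : grid k z -> circle z.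
Proof. by case=> j _ <-; exact: circle_gridpt. Qed.

Lemma Pi_grid S x i : Pi S x -> i \in S -> grid #|S| (x i).
Proof. by case=> s [h1 _ h] iS; rewrite h //; exists (s i) => //; exact: h1. Qed.

Lemma rate_ge0 : 0 <= rate R n. Proof. exact: sqrtr_ge0. Qed.

(** Both the base point and the tuple may change. The first stage uses this with two different
    tuples, row by row; the second with one tuple and two base points. *)
Lemma row_signal (cl cL ce : R) f S x x' z z' : 0 <= ce -> BL n cl cL ce f ->
  Pi S x -> Pi S x' -> grid #|S| z -> grid #|S| z' ->
  cl / 2 * (\sum_(j in S) (d z' (x' j) - d z (x j)) ^+ 2)
    - ce * rate R n * (\sum_(j in S) `|d z' (x' j) - d z (x j)|)
  <= \sum_(j in S) f z (x j) * (d z' (x' j) - d z (x j)).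
Proof.
move=> ce0 [_ _ _ fl] Px Px' gz gz'.
have cz := circle_grid gz.
have fl' j j' : j \in S -> j' \in S -> d z (x j') <= d z (x j) ->
    cl * (d z (x j) - d z (x j')) - ce * rate R n <= f z (x j') - f z (x j).
  by move=> jS jS'; apply: fl => //; exact: circle_Pi Px _.
case: Px => s [sS sI xE]; case: Px' => s' [sS' sI' xE'].
case: gz => a /= ak zE; case: gz' => a' /= ak' zE'.
pose w : R := 2 * pi / #|S|%:R.
pose X j := ndist #|S| a (s j); pose Y j := ndist #|S| a' (s' j).
have w0 : 0 <= w by rewrite divr_ge0 // mulr_ge0 // pi_ge0.
have EX j : j \in S -> d z (x j) = w * (X j)%:R.
  by move=> jS; rewrite -zE xE // d_gridpt // sS.
have EY j : j \in S -> d z' (x' j) = w * (Y j)%:R.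
  by move=> jS; rewrite -zE' xE' // d_gridpt // sS'.
have e0 : 0 <= ce * rate R n by rewrite mulr_ge0 // rate_ge0.
have XY (phi : nat -> R) : \sum_(j in S) phi (X j) = \sum_(j in S) phi (Y j).
  rewrite (sum_inj_card (fun m => phi (ndist #|S| a m)) sS sI).
  rewrite (sum_inj_card (fun m => phi (ndist #|S| a' m)) sS' sI').
  exact: sum_ndist.
have := @signal_lower_bound R _ S X Y (fun j => f z (x j)) w cl (ce * rate R n) w0 e0 XY.
have H : {in S &, forall j j', (X j' <= X j)%N ->
     cl * (w * (X j)%:R - w * (X j')%:R) - ce * rate R n <= f z (x j') - f z (x j)}.
  move=> j j' jS jS' h; rewrite -!EX //; apply: fl' => //.
  by rewrite !EX // ler_wpM2l // ler_nat.
move=> /(_ H).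
have E2 : \sum_(j in S) (d z' (x' j) - d z (x j)) ^+ 2
    = \sum_(j in S) (w * (Y j)%:R - w * (X j)%:R) ^+ 2.
  by apply: eq_bigr => j jS; rewrite EX // EY.
have E1 : \sum_(j in S) `|d z' (x' j) - d z (x j)|
    = \sum_(j in S) `|w * (Y j)%:R - w * (X j)%:R|.
  by apply: eq_bigr => j jS; rewrite EX // EY.
have EF : \sum_(j in S) f z (x j) * (d z' (x' j) - d z (x j))
    = \sum_(j in S) f z (x j) * (w * (Y j)%:R - w * (X j)%:R).
  by apply: eq_bigr => j jS; rewrite EX // EY.
by rewrite E2 E1 EF.
Qed.

End signal.

(** * Alignment of Gram matrices *)

Section ortho2.
Variable R : realType.
Implicit Types (x y z q m : 'cV[R]_2) (Q : 'M[R]_2).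

Lemma ord2P (i : 'I_2) : i = 0 \/ i = 1.
Proof. by case: i => -[|[|//]] h; [left|right]; apply/val_inj. Qed.

Definition rows2 q1 q2 : 'M[R]_2 := \matrix_(i, j) (if i == 0 then q1 j 0 else q2 j 0).

Lemma sum_ord2 (F : 'I_2 -> R) : \sum_i F i = F 0 + F 1.
Proof.
rewrite big_ord_recl big_ord1.
by have -> : lift ord0 ord0 = 1 :> 'I_2 by apply/val_inj.
Qed.

Lemma rows2_mul q1 q2 x : (rows2 q1 q2 *m x) 0 0 = dot q1 x /\
  (rows2 q1 q2 *m x) 1 0 = dot q2 x.
Proof. by rewrite !mxE !sum_ord2 !mxE /dot. Qed.

Lemma rows2_ortho q1 q2 : dot q1 q1 = 1 -> dot q2 q2 = 1 -> dot q1 q2 = 0 ->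
  orthogonal_group (rows2 q1 q2).
Proof.
move=> h1 h2 h3; rewrite /orthogonal_group /=; apply/matrixP => i j.
rewrite !mxE sum_ord2 !mxE.
have [->|->] := ord2P i; have [->|->] := ord2P j => //=.
by move: h3; rewrite dotC.
Qed.

Lemma norm_sqrt_sub1_le (t : R) u : 0 <= t -> `|t ^+ 2 - 1| <= u -> `|t - 1| <= u.
Proof.
move=> t0; apply: le_trans.
have -> : t ^+ 2 - 1 = (t - 1) * (t + 1) by ring.
by rewrite normrM ler_peMr // ger0_norm; lra.
Qed.

(* Gram-Schmidt *)
Lemma near_ortho m1 m2 (tau : R) : tau <= 1 / 2 ->
  `|dot m1 m1 - 1| <= tau -> `|dot m2 m2 - 1| <= tau -> `|dot m1 m2| <= tau ->
  exists q1 q2, [/\ orthogonal_group (rows2 q1 q2),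
    dot (q1 - m1) (q1 - m1) <= (4 * tau) ^+ 2 &
    dot (q2 - m2) (q2 - m2) <= (4 * tau) ^+ 2].
Proof.
move=> t2 h1 h2 h12; have t0 : 0 <= tau by apply: le_trans h1; exact: normr_ge0.
pose N := Num.sqrt (dot m1 m1).
have N0 : 0 <= N by exact: sqrtr_ge0.
have NE : N ^+ 2 = dot m1 m1 by rewrite sqr_sqrtr // dot_ge0.
have N1 : `|N - 1| <= tau by apply: norm_sqrt_sub1_le; rewrite ?NE.
have Nh : 1 / 2 <= N by move: N1; rewrite ler_norml; lra.
have Nn0 : N != 0 by rewrite gt_eqF //; lra.
pose q1 : 'cV[R]_2 := N^-1 *: m1.
have q11 : dot q1 q1 = 1.
  transitivity (N ^- 2 * dot m1 m1); first by rewrite /dot !mxE; field.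
  by rewrite -NE mulVf // expf_neq0.
(* The quarter turn of [q1], completing it to an orthonormal basis. *)
pose p : 'cV[R]_2 := \col_i (if i == 0 then - q1 1 0 else q1 0 0).
have pp : dot p p = 1 by rewrite -q11 /dot !mxE /=; ring.
have qp : dot q1 p = 0 by rewrite /dot !mxE /=; ring.
pose al := dot m2 q1; pose be := dot m2 p.
have abE : al ^+ 2 + be ^+ 2 = dot m2 m2.
  transitivity (dot m2 m2 * dot q1 q1); last by rewrite q11 mulr1.
  by rewrite /al /be /p /dot !mxE /=; ring.
have al_le : `|al| <= 2 * tau.
  have -> : al = N^-1 * dot m1 m2 by rewrite /al /q1 /dot !mxE; ring.
  rewrite normrM ger0_norm ?invr_ge0 // ler_pdivrMl; last by lra.
  apply: le_trans h12 _; nra.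
have al2 : al ^+ 2 <= (2 * tau) ^+ 2.
  by rewrite -[al ^+ 2]real_normK ?num_real // lerXn2r // nnegrE; lra.
(* The sign puts the second vector on the side of [m2]; rotations and reflections both occur. *)
pose s : R := if 0 <= be then 1 else -1.
have s2 : s ^+ 2 = 1 by rewrite /s; case: ifP => _; ring.
have sbe : s * be = `|be|.
  rewrite /s; case: (lerP 0 be) => h; rewrite ?mul1r ?mulN1r; first by rewrite ger0_norm.
  by rewrite ltr0_norm.
have be1 : `| `|be| - 1| <= 3 * tau.
  apply: norm_sqrt_sub1_le => //; rewrite real_normK ?num_real //.
  have -> : be ^+ 2 - 1 = (dot m2 m2 - 1) - al ^+ 2 by rewrite -abE; ring.
  apply: le_trans (ler_normB _ _) _; rewrite (ger0_norm (sqr_ge0 _)).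
  have : (2 * tau) ^+ 2 <= 2 * tau by nra.
  lra.
exists q1, (s *: p); split.
- apply: rows2_ortho => //.
    transitivity (s ^+ 2 * dot p p); first by rewrite /dot !mxE; ring.
    by rewrite s2 pp mulr1.
  transitivity (s * dot q1 p); first by rewrite /dot !mxE; ring.
  by rewrite qp mulr0.
- have -> : dot (q1 - m1) (q1 - m1) = (N - 1) ^+ 2.
    transitivity ((N^-1 - 1) ^+ 2 * dot m1 m1); first by rewrite /dot !mxE; ring.
    by rewrite -NE; field.
  rewrite -[(N - 1) ^+ 2]real_normK ?num_real // lerXn2r // ?nnegrE; lra.
- have -> : dot (s *: p - m2) (s *: p - m2) = al ^+ 2 + ( `|be| - 1) ^+ 2.
    transitivity (s ^+ 2 * dot p p - 2 * (s * be) + dot m2 m2).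
      by rewrite /be /dot !mxE; ring.
    rewrite -abE s2 pp sbe.
    have -> : be ^+ 2 = `|be| ^+ 2 by rewrite real_normK ?num_real.
    by ring.
  (* The errors are 2 tau along [q1] and 3 tau across it, and 2^2 + 3^2 <= 4^2. *)
  have : ( `|be| - 1) ^+ 2 <= (3 * tau) ^+ 2.
    by rewrite -[(_ - 1) ^+ 2]real_normK ?num_real // lerXn2r // nnegrE; lra.
  by nra.
Qed.

Lemma d_le_coord x y : circle x -> circle y ->
  d x y <= 8 * ( `|(x - y) 0 0| + `|(x - y) 1 0|).
Proof.
move=> cx cy; have /andP[d0 _] := d_itv cx cy.
rewrite -(@ler_pXn2r _ 2) // ?nnegrE //.
apply: le_trans (d_sq_le cx cy) _.
rewrite /dot; move: ((x - y) 0 0) ((x - y) 1 0) => a b.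
rewrite -!expr2 -[a ^+ 2]real_normK ?num_real // -[b ^+ 2]real_normK ?num_real //.
have := normr_ge0 a; have := normr_ge0 b; move: `|a| `|b| => u v u0 v0.
have := mulr_ge0 u0 v0; nra.
Qed.

Lemma norm_dot_le x y (t : R) : 0 <= t -> dot x x <= t ^+ 2 -> circle y -> `|dot x y| <= t.
Proof.
move=> t0 h /circleE cy; rewrite -(@ler_pXn2r _ 2) // ?nnegrE //.
by rewrite real_normK ?num_real //; apply: le_trans (dot_sqr_le _ _) _; rewrite cy mulr1.
Qed.

Lemma norm_coord_le1 x (a : 'I_2) : circle x -> `|x a 0| <= 1.
Proof.
move=> /circleE; rewrite /dot -!expr2 => h.
rewrite -(@ler_pXn2r _ 2) // ?nnegrE // real_normK ?num_real // expr1n -h.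
by have [->|->] := ord2P a; rewrite ?lerDl ?lerDr ?sqr_ge0.
Qed.

End ortho2.

Section align.
Variables (R : realType) (n : nat).
Implicit Types (S : {set 'I_n}) (x v : 'I_n -> 'cV[R]_2) (z : 'cV[R]_2).

Lemma sum_dot_Pi S x z z' : (2 < #|S|)%N -> Pi S x ->
  \sum_(i in S) dot z (x i) * dot z' (x i) = #|S|%:R / 2 * dot z z'.
Proof.
move=> S2 [s [sS sI xE]]; rewrite -sum_dot_grid //.
rewrite -(sum_inj_card (fun j => dot z (gridpt R #|S| j) * dot z' (gridpt R #|S| j)) sS sI).
by apply: eq_bigr => i iS; rewrite xE.
Qed.

(* Two enumerations of the grid with nearby Gram matrices G0 and Gh are nearly
   congruent: since G0 x0 = k/2 x0, the matrix M = 2/k * sum x0_j xh_j^T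
   satisfies M xh ~ x0, and M is nearly orthogonal by isotropy of xh. *)
Lemma gram_alignment S x0 xh (de : R) : (2 < #|S|)%N -> Pi S x0 -> Pi S xh ->
  de <= 1 / 48 ->
  \sum_(i in S) \sum_(j in S) `|d (xh i) (xh j) - d (x0 i) (x0 j)| <= #|S|%:R ^+ 2 * de ->
  exists2 U, orthogonal_group U & \sum_(i in S) d (xh i) (U *m x0 i) <= #|S|%:R * (1600 * de).
Proof.
move=> S2 P0 Ph de1; set k : R := #|S|%:R => L1.
have k0 : 0 < k by rewrite ltr0n; case: #|S| S2.
have kn0 : k != 0 by rewrite gt_eqF.
pose e (a : 'I_2) : 'cV[R]_2 := delta_mx a 0.
have dote a z : dot (e a) z = z a 0.
  by rewrite /dot /e !mxE; have [->|->] := ord2P a => /=; ring.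
(* [mm a] is row a of M, and [r a i] is coordinate a of the residual M xh_i - x0_i. *)
pose mm (a : 'I_2) : 'cV[R]_2 := \col_b ((2 / k) * \sum_(j in S) x0 j a 0 * xh j b 0).
pose r a i := dot (mm a) (xh i) - x0 i a 0.
have c0 i : i \in S -> circle (x0 i) by exact: circle_Pi P0.
have ch i : i \in S -> circle (xh i) by exact: circle_Pi Ph.
have mE a i : dot (mm a) (xh i) = 2 / k * \sum_(j in S) x0 j a 0 * dot (xh j) (xh i).
  rewrite {1}/dot !mxE -!mulrA -!mulrDr; congr (_ * (_ * _)).
  rewrite !mulr_suml -big_split /=; apply: eq_bigr => j _.
  by rewrite /dot; ring.
have xE a i : x0 i a 0 = 2 / k * \sum_(j in S) x0 j a 0 * dot (x0 j) (x0 i).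
  rewrite -(dote a (x0 i)).
  transitivity (2 / k * (k / 2 * dot (e a) (x0 i))); first by field.
  rewrite -(sum_dot_Pi _ _ S2 P0); congr (_ * _); apply: eq_bigr => j _.
  by rewrite dote [dot (x0 i) _]dotC.
have rE a i : r a i = 2 / k * \sum_(j in S) x0 j a 0 * (dot (xh j) (xh i) - dot (x0 j) (x0 i)).
  rewrite /r mE [X in _ - X]xE -mulrBr -sumrB; congr (_ * _).
  by apply: eq_bigr => j _; rewrite mulrBr.
have k2 : 0 <= 2 / k by rewrite divr_ge0 // ltW.
have r_le a i : i \in S -> `|r a i| <= 2 / k * \sum_(j in S) `|d (xh i) (xh j) - d (x0 i) (x0 j)|.
  move=> iS; rewrite rE normrM (ger0_norm k2) ler_wpM2l //.
  apply: le_trans (ler_norm_sum _ _ _) _; apply: ler_sum => j jS.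
  rewrite normrM -[leRHS]mul1r ler_pM //; first exact/norm_coord_le1/c0.
  rewrite (dotC (xh j)) (dotC (x0 j)) -!cos_d; try by [exact: c0|exact: ch].
  exact: norm_cosB_le.
(* A crude uniform bound, so that products of two residuals are controlled by their sum. *)
have r4 a i : i \in S -> `|r a i| <= 4.
  move=> iS; rewrite rE normrM (ger0_norm k2).
  have -> : 4 = 2 / k * (k * 2) :> R by field.
  rewrite ler_wpM2l //; apply: le_trans (ler_norm_sum _ _ _) _.
  rewrite /k mulr_natl -sumr_const; apply: ler_sum => j jS.
  rewrite normrM -[leRHS]mul1r ler_pM //; first exact/norm_coord_le1/c0.
  rewrite -!cos_d; try by [exact: c0|exact: ch].
  have := cos_max (d (xh j) (xh i)); have := cos_max (d (x0 j) (x0 i)).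
  by rewrite !ler_norml; lra.
have sum_r a : \sum_(i in S) `|r a i| <= k * (2 * de).
  have -> : k * (2 * de) = 2 / k * (k ^+ 2 * de) by field.
  apply: le_trans (_ : \sum_(i in S) 2 / k * \sum_(j in S) `|d (xh i) (xh j) - d (x0 i) (x0 j)| <= _).
    by apply: ler_sum => i iS; exact: r_le.
  by rewrite -mulr_sumr ler_wpM2l.
(* By isotropy of [xh], k/2 times an entry of M M^T is a sum of products of coordinates of M xh = x0
   + r; isotropy of [x0] removes the identity, and every remaining term contains a residual. *)
have gram a b : `|dot (mm a) (mm b) - dot (e a) (e b)| <= 24 * de.
  have -> : dot (mm a) (mm b) - dot (e a) (e b) = 2 / k *
     \sum_(i in S) (x0 i a 0 * r b i + x0 i b 0 * r a i + r a i * r b i).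
    transitivity (2 / k * (k / 2 * dot (mm a) (mm b) - k / 2 * dot (e a) (e b))); first by field.
    rewrite -(sum_dot_Pi _ _ S2 Ph) -(sum_dot_Pi _ _ S2 P0) -sumrB; congr (_ * _).
    by apply: eq_bigr => i _; rewrite !dote /r; ring.
  rewrite normrM (ger0_norm k2).
  have -> : 24 * de = 2 / k * (k * (2 * de) + k * (2 * de) + 4 * (k * (2 * de))) by field.
  rewrite ler_wpM2l //; apply: le_trans (ler_norm_sum _ _ _) _.
  apply: le_trans (_ : \sum_(i in S) ( `|r b i| + `|r a i| + 4 * `|r b i|) <= _).
    apply: ler_sum => i iS; apply: le_trans (ler_normD _ _) _.
    apply: lerD; last by rewrite normrM ler_wpM2r // r4.
    apply: le_trans (ler_normD _ _) _.
    by apply: lerD; rewrite normrM ler_piMl //; exact/norm_coord_le1/c0.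
  by rewrite !big_split /= -mulr_sumr; have := sum_r a; have := sum_r b; lra.
have ee a b : dot (e a) (e b) = (a == b)%:R by rewrite dote /e mxE andbT.
have g00 := gram 0 0; have g11 := gram 1 1; have g01 := gram 0 1.
rewrite !ee /= in g00 g11 g01; rewrite subr0 in g01.
(* The reason for the threshold 1/48. *)
have t2 : 24 * de <= 1 / 2 by lra.
have de0 : 0 <= de by have := le_trans (normr_ge0 _) g00; lra.
have [q1 [q2 [oQ hq1 hq2]]] := near_ortho t2 g00 g11 g01.
set Q := rows2 q1 q2 in oQ.
exists Q^T; first exact: ortho_trmx.
(* Here 96 = 4 * 24 comes from [near_ortho]. Summed over [S], this gives the factor 8 (2 + 96 + 2 +
   96) = 1568, rounded up to 1600. *)
have di i : i \in S -> d (xh i) (Q^T *m x0 i) <=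
    8 * (( `|r 0 i| + 96 * de) + ( `|r 1 i| + 96 * de)).
  move=> iS; rewrite -(d_ortho oQ); [|exact: ch|exact/circle_ortho/c0/iS/ortho_trmx].
  rewrite ortho_trK //.
  apply: le_trans (d_le_coord _ _) _; [exact/circle_ortho/ch|exact: c0|].
  have [E0 E1] := rows2_mul q1 q2 (xh i).
  have t0 : 0 <= 4 * (24 * de) by lra.
  have := norm_dot_le t0 hq1 (ch _ iS); have := norm_dot_le t0 hq2 (ch _ iS).
  have -> : (Q *m xh i - x0 i) 0 0 = dot (q1 - mm 0) (xh i) + r 0 i.
    by rewrite mxE E0 dotBl /r mxE; ring.
  have -> : (Q *m xh i - x0 i) 1 0 = dot (q2 - mm 1) (xh i) + r 1 i.
    by rewrite mxE E1 dotBl /r mxE; ring.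
  move=> h1 h2; rewrite ler_pM2l //.
  by apply: lerD; apply: le_trans (ler_normD _ _) _; lra.
apply: le_trans (ler_sum _ di) _.
rewrite -mulr_sumr !big_split /= sumr_const -(mulr_natl (96 * de)) -/k.
have := sum_r 0; have := sum_r 1.
have := mulr_ge0 (ltW k0) de0.
by lra.
Qed.

End align.

(** * Localization for a fixed realization of the noise *)

Section stages.
Variables (R : realType) (n : nat) (cl cL ce : R).
Implicit Types (S : {set 'I_n}) (xh v xs : 'I_n -> 'cV[R]_2) (x y z : 'cV[R]_2)
  (f : 'cV[R]_2 -> 'cV[R]_2 -> R) (F A : 'M[R]_n) (U : 'M[R]_2).
Hypotheses (ce0 : 0 <= ce) (cl0 : 0 < cl) (cL0 : 0 <= cL).

Let eps : R := ce * rate R n.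

Let eps0 : 0 <= eps. Proof. by rewrite mulr_ge0 // rate_ge0. Qed.

Lemma BL_ortho f U : orthogonal_group U -> BL n cl cL ce f ->
  BL n cl cL ce (fun a b => f (U *m a) (U *m b)).
Proof.
move=> oU [f1 f2 f3 f4]; split.
- by move=> x y cx cy; apply: f1; exact: circle_ortho.
- by move=> x y cx cy; apply: f2; exact: circle_ortho.
- by move=> x y y' cx cy cy'; rewrite -(d_ortho oU cy cy'); apply: f3; exact: circle_ortho.
- move=> x y y' cx cy cy'; rewrite -(d_ortho oU cx cy') -(d_ortho oU cx cy).
  by apply: f4; exact: circle_ortho.
Qed.

Lemma BL_lip f x y x' y' : BL n cl cL ce f ->
  circle x -> circle y -> circle x' -> circle y' ->
  `|f x y - f x' y'| <= cL * (d x x' + d y y') + 2 * eps.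
Proof.
move=> [f1 _ f3 _] cx cy cx' cy'.
have -> : f x y - f x' y' = (f x y - f x y') + (f y' x - f y' x').
  by rewrite (f1 y' x) // (f1 y' x') // subrKA.
apply: le_trans (ler_normD _ _) _.
have := f3 x y y' cx cy cy'; have := f3 y' x x' cy' cx cx'.
by rewrite -/eps; lra.
Qed.

(** Optimality bounds the signal by the noise. The signal is quadratic in the discrepancy of the
    Gram matrices, while the bias from replacing [x0] by [xs] and the noise are linear in it;
    dividing by its Frobenius norm leaves the rate. *)
Lemma stage1_gram S xs (x0 : 'I_n -> 'cV[R]_2) xh f F A (eta tau : R) :
  0 <= eta -> 0 <= tau ->
  BL n cl cL ce f -> Pi S x0 -> Pi S xh -> (0 < #|S|)%N ->
  {in S, forall i, circle (xs i)} ->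
  {in S, forall i, d (xs i) (x0 i) <= eta} ->
  {in S &, forall i j, i != j -> F i j = f (xs i) (xs j)} ->
  \sum_(i in S) \sum_(j in S) A i j * d (xh i) (xh j) <=
    \sum_(i in S) \sum_(j in S) A i j * d (x0 i) (x0 j) ->
  \sum_(i in S) \sum_(j in S) (A i j - F i j) * (d (x0 i) (x0 j) - d (xh i) (xh j)) <=
    tau * #|S|%:R * Num.sqrt (\sum_(i in S) \sum_(j in S) (d (x0 i) (x0 j) - d (xh i) (xh j)) ^+ 2) ->
  \sum_(i in S) \sum_(j in S) `|d (xh i) (xh j) - d (x0 i) (x0 j)| <=
    #|S|%:R ^+ 2 * (2 / cl * (2 * cL * eta + 3 * eps + tau)).
Proof.
move=> eta0 tau0 fBL P0 Ph S0 cs near FE obj noise.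
have c0 i : i \in S -> circle (x0 i) by exact: circle_Pi P0.
have ch i : i \in S -> circle (xh i) by exact: circle_Pi Ph.
set k : R := #|S|%:R in noise *.
have k0 : 0 < k by rewrite ltr0n.
pose De i j := d (xh i) (xh j) - d (x0 i) (x0 j).
have De0 i : i \in S -> De i i = 0.
  by move=> iS; rewrite /De !dxx ?subrr //; [exact: c0|exact: ch].
set L1 := \sum_(i in S) \sum_(j in S) `|_|.
set Q := \sum_(i in S) \sum_(j in S) (_ ^+ 2) in noise.
have QE : Q = \sum_(i in S) \sum_(j in S) De i j ^+ 2.
  by apply: eq_bigr => i _; apply: eq_bigr => j _; rewrite -sqrrN opprB.
have Q0 : 0 <= Q by rewrite QE; do 2 (apply: sumr_ge0 => ? _); exact: sqr_ge0.
have L10 : 0 <= L1 by do 2 (apply: sumr_ge0 => ? _); exact: normr_ge0.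
pose L := Num.sqrt Q; have L0 : 0 <= L by exact: sqrtr_ge0.
have LQ : L ^+ 2 = Q by exact: sqr_sqrtr.
have L1L : L1 <= k * L.
  rewrite -(@ler_pXn2r _ 2) // ?nnegrE //; last by rewrite mulr_ge0 // ltW.
  apply: le_trans (_ : (\sum_(i in S) `|\sum_(j in S) `|De i j| |) ^+ 2 <= _).
    rewrite (_ : L1 = \sum_(i in S) `|\sum_(j in S) `|De i j| |) //.
    by apply: eq_bigr => i _; rewrite ger0_norm // sumr_ge0.
  apply: le_trans (sqr_sum_norm_le _ _) _.
  rewrite exprMn LQ QE expr2 -mulrA ler_wpM2l ?ler0n // mulr_sumr.
  by apply: ler_sum => i _; exact: sqr_sum_norm_le.
have signal : cl / 2 * Q - eps * L1 <= \sum_(i in S) \sum_(j in S) f (x0 i) (x0 j) * De i j.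
  rewrite QE !mulr_sumr -sumrB; apply: ler_sum => i iS.
  exact: (row_signal ce0 fBL P0 Ph (Pi_grid P0 iS) (Pi_grid Ph iS)).
have FA : \sum_(i in S) \sum_(j in S) F i j * De i j <= tau * k * L.
  apply: le_trans noise.
  rewrite -subr_ge0 -sumrB.
  rewrite (_ : \sum_(i in S) _ = \sum_(i in S) \sum_(j in S) A i j * d (x0 i) (x0 j)
     - \sum_(i in S) \sum_(j in S) A i j * d (xh i) (xh j)); first by rewrite subr_ge0.
  rewrite -sumrB; apply: eq_bigr => i _; rewrite -!sumrB; apply: eq_bigr => j _.
  by rewrite /De; ring.
have fF : \sum_(i in S) \sum_(j in S) f (x0 i) (x0 j) * De i j <=
    \sum_(i in S) \sum_(j in S) F i j * De i j + (2 * cL * eta + 2 * eps) * L1.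
  rewrite mulr_sumr -big_split; apply: ler_sum => i iS.
  rewrite /= mulr_sumr -big_split; apply: ler_sum => j jS /=.
  (* On the diagonal [F] is not tied to [f], but both distance matrices vanish there. *)
  have [<-|ij] := eqVneq i j.
    by rewrite -/(De i i) De0 // normr0 !mulr0 addr0.
  rewrite FE // -lerBlDl -mulrBl.
  apply: le_trans (ler_norm _) _; rewrite normrM -/(De i j) ler_wpM2r //.
  apply: le_trans (BL_lip fBL (c0 _ iS) (c0 _ jS) (cs _ iS) (cs _ jS)) _.
  rewrite lerD2r (mulrC 2) -mulrA ler_wpM2l //.
  by rewrite !(d_sym (x0 _)); have := near _ iS; have := near _ jS; lra.
have main : cl / 2 * Q <= (2 * cL * eta + 3 * eps) * L1 + tau * k * L.
  by move: signal fF FA; lra.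
apply: (le_trans L1L); rewrite expr2 -mulrA ler_wpM2l ?(ltW k0) //.
have b0 : 0 <= 2 * cL * eta + 3 * eps.
  by rewrite addr_ge0 // mulr_ge0 // mulr_ge0.
have [->|Ln0] := eqVneq L 0.
  by rewrite mulr_ge0 ?(ltW k0) // mulr_ge0 ?divr_ge0 ?(ltW cl0) // addr_ge0.
have Lp : 0 < L by rewrite lt_def Ln0.
have step : cl / 2 * L * L <= k * (2 * cL * eta + 3 * eps + tau) * L.
  rewrite -mulrA -expr2 LQ (le_trans main) //.
  have := ler_wpM2l b0 L1L; lra.
rewrite ler_pM2r // in step.
by rewrite mulrCA -[2 / cl]invf_div ler_pdivlMl ?divr_gt0.
Qed.

Lemma stage1 S xs (x0 : 'I_n -> 'cV[R]_2) xh f F A (eta tau : R) :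
  (2 < #|S|)%N -> 0 <= eta -> 0 <= tau ->
  BL n cl cL ce f -> Pi S x0 -> Pi S xh ->
  {in S, forall i, circle (xs i)} ->
  {in S, forall i, d (xs i) (x0 i) <= eta} ->
  {in S &, forall i j, i != j -> F i j = f (xs i) (xs j)} ->
  \sum_(i in S) \sum_(j in S) A i j * d (xh i) (xh j) <=
    \sum_(i in S) \sum_(j in S) A i j * d (x0 i) (x0 j) ->
  \sum_(i in S) \sum_(j in S) (A i j - F i j) * (d (x0 i) (x0 j) - d (xh i) (xh j)) <=
    tau * #|S|%:R * Num.sqrt (\sum_(i in S) \sum_(j in S) (d (x0 i) (x0 j) - d (xh i) (xh j)) ^+ 2) ->
  2 / cl * (2 * cL * eta + 3 * eps + tau) <= 1 / 48 ->
  exists2 U, orthogonal_group U & \sum_(i in S) d (xh i) (U *m xs i) <=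
    #|S|%:R * (1600 * (2 / cl * (2 * cL * eta + 3 * eps + tau)) + eta).
Proof.
move=> S2 eta0 tau0 fBL P0 Ph cs near FE obj noise de1.
have S0 : (0 < #|S|)%N by case: #|S| S2.
have [U oU hU] := gram_alignment S2 P0 Ph de1
  (stage1_gram eta0 tau0 fBL P0 Ph S0 cs near FE obj noise).
exists U => //; rewrite mulrDr; apply: le_trans (lerD hU (lexx _)).
rewrite mulr_natl -sumr_const -big_split; apply: ler_sum => i iS /=.
have ci := cs _ iS; have c0 := circle_Pi P0 iS.
apply: le_trans (@d_triangle _ (U *m x0 i) _ _ _ _ _) _; try exact: circle_ortho.
  exact: circle_Pi Ph iS.
by rewrite lerD2l d_ortho // d_sym near.
Qed.

(** The minimizer [z] is compared with a grid point [y] close to the target. All perturbations are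
    at most linear in h = d(y, z) because the rows of [y] and [z] differ by at most h entrywise, and
    isotropy makes the signal at least of order k h^2. Only the average error of [v] enters, through
    the Lipschitz condition. *)
Lemma stage2 S xs v z U i f F A (kappa tau : R) :
  (2 < #|S|)%N -> BL n cl cL ce f -> Pi S v -> orthogonal_group U ->
  (forall j, circle (xs j)) ->
  \sum_(j in S) d (v j) (U *m xs j) <= #|S|%:R * kappa ->
  {in S, forall j, F i j = f (xs i) (xs j)} -> 0 <= tau ->
  argmin (@grid R #|S|) (fun y => \sum_(j in S) A i j * d y (v j)) z ->
  (forall y, grid #|S| y ->
    \sum_(j in S) (A i j - F i j) * (d y (v j) - d z (v j)) <= tau * #|S|%:R * d y z) ->
  d z (U *m xs i) <=
    256 / cl * (3 * eps + cL * kappa + cL * (2 * pi / #|S|%:R) + tau) + 2 * pi / #|S|%:R.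
Proof.
move=> S2 fBL Pv oU cs kap FE tau0 [gz zmin] noise.
have S0 : (0 < #|S|)%N by case: #|S| S2.
have cU j : circle (U *m xs j) by exact: circle_ortho.
have cv j : j \in S -> circle (v j) by exact: circle_Pi Pv.
set k : R := #|S|%:R in kap noise *; have k0 : 0 < k by rewrite ltr0n.
set ga := 2 * pi / k.
have [a ak hy] := near_grid S0 (cU i).
set y := gridpt _ _ a in hy; have gy : grid #|S| y by exists a.
have cy : circle y by exact: circle_gridpt.
have cz : circle z by exact: circle_grid gz.
set h := d y z; have /andP[h0 _] : 0 <= h <= pi by exact: d_itv.
pose c j := d z (v j) - d y (v j).
have c_le j : j \in S -> `|c j| <= h.
  by move=> jS; rewrite /h (d_sym y); apply: normB_d_le => //; exact: cv.
(* [f] in the frame of the estimate, where the true positions U x_j lie close to [v] on average. *)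
pose g u w := f (U^T *m u) (U^T *m w).
have gBL : BL n cl cL ce g by exact/BL_ortho/fBL/ortho_trmx.
have gF j : j \in S -> F i j = g (U *m xs i) (U *m xs j).
  by move=> jS; rewrite FE // /g !ortho_Ktr.
have signal := row_signal ce0 gBL Pv Pv gy gz.
have FA : \sum_(j in S) F i j * c j <= tau * k * h.
  apply: le_trans (noise _ gy); rewrite -subr_ge0 -sumrB.
  rewrite (_ : \sum_(j in S) _ = \sum_(j in S) A i j * d y (v j)
     - \sum_(j in S) A i j * d z (v j)); first by rewrite subr_ge0 zmin.
  by rewrite -sumrB; apply: eq_bigr => j _; rewrite /c; ring.
have gFc : \sum_(j in S) g y (v j) * c j <= \sum_(j in S) F i j * c j
    + h * \sum_(j in S) (cL * ga + 2 * eps + cL * d (v j) (U *m xs j)).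
  rewrite mulr_sumr -big_split; apply: ler_sum => j jS /=.
  rewrite -lerBlDl -mulrBl gF // mulrC.
  apply: le_trans (ler_norm _) _; rewrite normrM ler_pM // ?c_le //.
  apply: le_trans (BL_lip gBL cy (cv _ jS) (cU _) (cU _)) _.
  have := ler_wpM2l cL0 hy; rewrite -/k -/ga; lra.
have sumB : \sum_(j in S) (cL * ga + 2 * eps + cL * d (v j) (U *m xs j)) <=
    k * (cL * ga + 2 * eps + cL * kappa).
  rewrite big_split /= sumr_const -mulr_sumr -(mulr_natl (cL * ga + 2 * eps)) -/k.
  by have := ler_wpM2l cL0 kap; lra.
have sumc : \sum_(j in S) `|c j| <= k * h.
  by rewrite /k mulr_natl -sumr_const; apply: ler_sum => j jS; exact: c_le.
(* Differences of scalar products are bounded by differences of distances, and isotropy sums the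
   former to k/2 times the squared chord; 128 is 2 * 64, with 64 from [d_sq_le]. *)
have sumc2 : k / 128 * h ^+ 2 <= \sum_(j in S) c j ^+ 2.
  have := d_sq_le cz cy; rewrite (d_sym z) -/h => hh.
  apply: le_trans (_ : k / 2 * dot (z - y) (z - y) <= _).
    by have := ler_wpM2l (ltW k0) hh; lra.
  rewrite -(sum_dot_Pi _ _ S2 Pv); apply: ler_sum => j jS.
  rewrite -expr2 dotBl -[_ ^+ 2]real_normK ?num_real // -[leRHS]real_normK ?num_real //.
  by rewrite lerXn2r // ?nnegrE //; apply: norm_dotB_le => //; exact: cv.
have main : cl / 256 * k * h ^+ 2 <= h * (k * (3 * eps + cL * kappa + cL * ga + tau)).
  have e1 := ler_wpM2l eps0 sumc; have e2 := ler_wpM2l h0 sumB.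
  have e3 : cl / 2 * (k / 128 * h ^+ 2) <= cl / 2 * \sum_(j in S) c j ^+ 2.
    by rewrite ler_wpM2l // divr_ge0 // ltW.
  move: signal; rewrite -/eps => signal; rewrite /c in gFc FA e1 e3.
  by lra.
have hle : h <= 256 / cl * (3 * eps + cL * kappa + cL * ga + tau).
  have [->|hn0] := eqVneq h 0.
    have ga0 : 0 <= ga by rewrite divr_ge0 ?mulr_ge0 ?pi_ge0 // ltW.
    have kap0 : 0 <= kappa.
      rewrite -(pmulr_rge0 _ k0); apply: le_trans kap; apply: sumr_ge0 => j jS.
      by have /andP[] := d_itv (cv _ jS) (cU j).
    apply: mulr_ge0; first by apply: divr_ge0; [exact: ler0n|exact: ltW].
    by rewrite !addr_ge0 // mulr_ge0.
  have hp : 0 < h by rewrite lt_def hn0.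
  have : (cl / 256 * k * h) * h <= (k * (3 * eps + cL * kappa + cL * ga + tau)) * h.
    by rewrite -mulrA -expr2 [leRHS]mulrC.
  rewrite ler_pM2r // mulrAC [leLHS]mulrC ler_pM2l // => {}h1.
  by rewrite -[256 / cl]invf_div ler_pdivlMl //; apply: divr_gt0; last exact: ltr0n.
apply: le_trans (@d_triangle _ y _ _ cz cy (cU i)) _.
by rewrite (d_sym z); apply: lerD.
Qed.

End stages.

(** * Refinement and the distance to the grid *)

Section dinf.
Variables (R : realType) (n : nat).
Implicit Types (S : {set 'I_n}) (x y : 'I_n -> 'cV[R]_2).

Lemma dinf_ge S x y i : i \in S -> d (x i) (y i) <= dinf S x y.
Proof. by move=> iS; rewrite /dinf (bigD1 i) //= le_max lexx. Qed.

Lemma dinf_le S x y (c : R) : 0 <= c -> {in S, forall i, d (x i) (y i) <= c} ->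
  dinf S x y <= c.
Proof.
by move=> c0 h; rewrite /dinf; elim/big_ind: _ => // a b; rewrite ge_max => -> ->.
Qed.

Lemma dinf_ge0 S x y : 0 <= dinf S x y.
Proof. by rewrite /dinf; elim/big_rec: _ => // i a _ a0; rewrite le_max a0 orbT. Qed.

Lemma dinf_ortho S x y V : orthogonal_group V -> (forall i, circle (x i)) ->
  {in S, forall i, circle (y i)} ->
  dinf S (fun i => V *m x i) (fun i => V *m y i) = dinf S x y.
Proof.
by move=> oV cx cy; apply: eq_bigr => i iS; apply: d_ortho => //; exact: cy.
Qed.

Lemma dPi_has_lbound x : has_lbound [set dinf [set: 'I_n] x y | y in Pi [set: 'I_n]].
Proof. by exists 0 => _ [y _ <-]; exact: dinf_ge0. Qed.

Lemma Pi_setT_neq0 : exists y : 'I_n -> 'cV[R]_2, Pi [set: 'I_n] y.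
Proof.
exists (fun i => gridpt R n i); exists (fun i => val i).
rewrite cardsT card_ord; split => // [i _|i j _ _]; first exact: ltn_ord.
exact: val_inj.
Qed.

(** A positive slack allows the infimum to be approached without exhibiting a minimizer; the slack
    will be the rate. *)
Lemma dPi_near x (c : R) : 0 < c ->
  exists2 y, Pi [set: 'I_n] y & forall i, d (x i) (y i) <= dPi x + c.
Proof.
move=> c0; set A := [set dinf [set: 'I_n] x y | y in Pi [set: 'I_n]].
have hA : has_inf A.
  have [y Py] := Pi_setT_neq0.
  by split; [exists (dinf [set: 'I_n] x y), y|exact: dPi_has_lbound].
have [_ [y Py <-] h] := inf_adherent c0 hA.
by exists y => // i; apply: le_trans (ltW h); apply: dinf_ge; rewrite inE.
Qed.

Lemma dPi_ge0 x : 0 <= dPi x.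
Proof.
have [y Py] := Pi_setT_neq0.
apply: lb_le_inf; first by exists (dinf [set: 'I_n] x y), y.
by move=> _ [z _ <-]; exact: dinf_ge0.
Qed.

Lemma dPi_ortho_le x V : orthogonal_group V -> (forall i, circle (x i)) ->
  (forall y, Pi [set: 'I_n] y -> Pi [set: 'I_n] (fun i => V *m y i)) ->
  dPi (fun i => V *m x i) <= dPi x.
Proof.
move=> oV cx PV; have [y Py] := Pi_setT_neq0.
apply: lb_le_inf; first by exists (dinf [set: 'I_n] x y), y.
move=> _ [z Pz <-]; apply: ge_inf; first exact: dPi_has_lbound.
exists (fun i => V *m z i); first exact: PV.
by apply: dinf_ortho => // i iT; exact: circle_Pi Pz iT.
Qed.

End dinf.

(* Only dihedral isometries preserve [Pi], so the orthogonal matrix produced by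
   the alignment is rounded to one of them, at cost 2 pi / n. *)
Section dihedral.
Variable R : realType.
Implicit Types (x y : 'cV[R]_2) (U V : 'M[R]_2) (t : R).

(** The rotation by [t] when [s] is false; the reflection sending the angle u to t - u when [s] is
    true. *)
Definition isom2 t (s : bool) : 'M[R]_2 :=
  \matrix_(i, j) (if i == 0 then if j == 0 then cos t else (-1) ^+ (~~ s) * sin t
                  else if j == 0 then sin t else (-1) ^+ s * cos t).

Lemma isom2_expi t s u : isom2 t s *m expi u = expi (t + (-1) ^+ s * u).
Proof.
apply/colP => i; rewrite !mxE sum_ord2 !mxE /=.
have [->|->] := ord2P i => /=; case: s; rewrite /= ?expr0 ?expr1 ?mul1r ?mulN1r.
- by rewrite cosB.
- by rewrite cosD mulNr.
- by rewrite sinB mulNr.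
- by rewrite sinD.
Qed.

Lemma isom2_ortho t s : orthogonal_group (isom2 t s).
Proof.
have cs := cos2Dsin2 t.
rewrite /orthogonal_group /=; apply/matrixP => i j; rewrite !mxE sum_ord2 !mxE /=.
have [->|->] := ord2P i; have [->|->] := ord2P j => /=; case: s; rewrite /= ?expr0 ?expr1;
 rewrite ?mul1r ?mulN1r ?mulr1n ?mulr0n -?cs; ring.
Qed.

(** The first column is a unit vector, so it has an angle t. The second is orthogonal to it, hence b
    times its quarter turn, and its length forces b = 1 or b = -1. *)
Lemma orthoP U : orthogonal_group U -> exists t s, U = isom2 t s.
Proof.
move=> oU; have := ortho_trmx oU; rewrite /orthogonal_group /= trmxK => h.
have h00 := congr1 (fun M : 'M[R]_2 => M 0 0) h.
have h11 := congr1 (fun M : 'M[R]_2 => M 1 1) h.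
have h01 := congr1 (fun M : 'M[R]_2 => M 0 1) h.
rewrite !mxE !sum_ord2 !mxE /= ?mulr1n ?mulr0n in h00 h11 h01.
pose u : 'cV[R]_2 := col 0 U.
have cu : circle u by rewrite /circle /= !mxE !expr2.
have [_ uE] := ArgP cu; set t := Arg u in uE.
have c0 : U 0 0 = cos t by have := congr1 (fun M : 'cV[R]_2 => M 0 0) uE; rewrite !mxE.
have c1 : U 1 0 = sin t by have := congr1 (fun M : 'cV[R]_2 => M 1 0) uE; rewrite !mxE.
have cs := cos2Dsin2 t.
rewrite c0 c1 in h01.
pose b := - sin t * U 0 1 + cos t * U 1 1.
have E0 : U 0 1 = - sin t * b.
  transitivity (U 0 1 * (cos t ^+ 2 + sin t ^+ 2)); first by rewrite cs mulr1.
  transitivity (cos t * (cos t * U 0 1 + sin t * U 1 1) - sin t * b); first by rewrite /b; ring.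
  by rewrite h01; ring.
have E1 : U 1 1 = cos t * b.
  transitivity (U 1 1 * (cos t ^+ 2 + sin t ^+ 2)); first by rewrite cs mulr1.
  transitivity (sin t * (cos t * U 0 1 + sin t * U 1 1) + cos t * b); first by rewrite /b; ring.
  by rewrite h01; ring.
have : b ^+ 2 == 1.
  apply/eqP; rewrite -h11 E0 E1.
  transitivity (b ^+ 2 * (cos t ^+ 2 + sin t ^+ 2)); first by rewrite cs mulr1.
  by ring.
rewrite sqrf_eq1 => /orP[]/eqP b1; rewrite b1 ?mulr1 ?mulrN1 ?opprK in E0 E1.
  exists t, false; apply/matrixP => i j; rewrite mxE.
  by have [->|->] := ord2P i; have [->|->] := ord2P j; rewrite /= ?expr0 ?expr1 ?mulN1r ?mul1r.
exists t, true; apply/matrixP => i j; rewrite mxE.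
by have [->|->] := ord2P i; have [->|->] := ord2P j; rewrite /= ?expr0 ?expr1 ?mulN1r ?mul1r.
Qed.

Lemma gridpt_modn k m : gridpt R k (m %% k) = gridpt R k m.
Proof.
have [->|k0] := posnP k; first by rewrite modn0.
have kn0 : k%:R != 0 :> R by rewrite pnatr_eq0 -lt0n.
rewrite {2}(divn_eq m k) /gridpt.
have -> : 2 * pi * (m %/ k * k + m %% k)%N%:R / k%:R =
   2 * pi * (m %% k)%:R / k%:R + (pi *+ 2) *+ (m %/ k) :> R.
  by rewrite natrD natrM -[(_ *+ 2) *+ _]mulr_natl -[_ *+ 2]mulr_natl; field.
apply/colP => i; rewrite !mxE.
by rewrite (periodicn (@cosD2pi R)) (periodicn (@sinD2pi R)).
Qed.

Lemma isom2_gridpt k a s j : (j < k)%N ->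
  exists2 j', (j' < k)%N & isom2 (2 * pi * a%:R / k%:R) s *m gridpt R k j = gridpt R k j'.
Proof.
move=> jk; have k0 : (0 < k)%N by lia.
have kn0 : k%:R != 0 :> R by rewrite pnatr_eq0 -lt0n.
(* For a reflection, k is added to a - j to stay within the natural numbers; the extra full turn is
   removed by [expiD2pi]. *)
exists ((if s then a + (k - j) else a + j) %% k)%N; first exact: ltn_pmod.
rewrite gridpt_modn isom2_expi /gridpt; case: s; rewrite ?expr1 ?expr0.
  rewrite -expiD2pi; congr expi.
  by rewrite natrD natrB ?(ltnW jk) // -mulr_natl; field.
by congr expi; rewrite natrD; field.
Qed.

(** The angle of [U] is rounded to a grid angle with the orientation kept. Two isometries of the
    same orientation differ by a rotation, which moves every point by the same distance. *)
Lemma near_dihedral n U : (0 < n)%N -> orthogonal_group U ->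
  exists V, [/\ orthogonal_group V,
    forall x, circle x -> d (U *m x) (V *m x) <= 2 * pi / n%:R &
    forall w : 'I_n -> 'cV[R]_2, Pi [set: 'I_n] w -> Pi [set: 'I_n] (fun i => V *m w i)].
Proof.
move=> n0 oU; have [t [s UE]] := orthoP oU.
have [a an ha] := near_grid n0 (circle_expi t).
set V := isom2 (2 * pi * a%:R / n%:R) s.
have oV : orthogonal_group V by exact: isom2_ortho.
exists V; split => //.
- move=> x cx; suff -> : d (U *m x) (V *m x) = d (expi t) (gridpt R n a) by rewrite d_sym.
  have [_ ->] := ArgP cx.
  apply: (@cos_inj R); rewrite ?in_itv /=; try apply: d_itv;
    try by [exact: circle_expi|exact/circle_ortho/circle_expi].
  rewrite !cos_d; try by [exact: circle_expi|exact/circle_ortho/circle_expi].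
  by rewrite UE !isom2_expi !dot_expi; congr cos; ring.
- move=> y [r [rS rI yE]]; rewrite cardsT card_ord in rS yE.
  have /choice[g gE] : forall j, exists j', (j < n)%N ->
      (j' < n)%N /\ V *m gridpt R n j = gridpt R n j'.
    move=> j; case: (ltnP j n) => jn; last by exists 0%N.
    by have [j' j'n E] := isom2_gridpt a s jn; exists j'.
  exists (g \o r); rewrite cardsT card_ord; split.
  + by move=> i iT /=; have [] := gE _ (rS i iT).
  + move=> i j iT jT /= E; apply: rI => //; apply: (@gridpt_inj R n); try exact: rS.
    rewrite -(ortho_Ktr (gridpt R n (r i)) oV) (gE _ (rS i iT)).2 E.
    by rewrite -(gE _ (rS j jT)).2 ortho_Ktr.
  + by move=> i iT /=; rewrite yE // (gE _ (rS i iT)).2.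
Qed.

End dihedral.

(** * Isotropy outside the two samples and matching of the two stages *)

Section refinement.
Variables (R : realType) (n : nat).
Implicit Types (S T : {set 'I_n}) (xs z y : 'I_n -> 'cV[R]_2) (U V W : 'M[R]_2).

Lemma dot_sqrB_le (u x y : 'cV[R]_2) (eta : R) : circle x -> circle y -> d x y <= eta ->
  `|dot u x ^+ 2 - dot u y ^+ 2| <= 2 * eta * dot u u.
Proof.
move=> cx cy dxy; have /andP[d0 _] := d_itv cx cy.
have -> : dot u x ^+ 2 - dot u y ^+ 2 = dot u (x - y) * (dot u x + dot u y).
  by rewrite dotBr; ring.
pose N := Num.sqrt (dot u u); have N0 : 0 <= N by exact: sqrtr_ge0.
have NE : N ^+ 2 = dot u u by rewrite sqr_sqrtr // dot_ge0.
have h1 : `|dot u (x - y)| <= N * eta.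
  have e0 := le_trans d0 dxy.
  rewrite -(@ler_pXn2r _ 2) // ?nnegrE // ?mulr_ge0 // real_normK ?num_real //.
  apply: le_trans (dot_sqr_le _ _) _; rewrite exprMn NE ler_wpM2l ?dot_ge0 //.
  by apply: le_trans (dot_sub_le cx cy) _; rewrite lerXn2r.
have hN x' : circle x' -> `|dot u x'| <= N by apply: norm_dot_le; rewrite ?NE.
have h2 : `|dot u x + dot u y| <= 2 * N.
  apply: le_trans (ler_normD _ _) _; have := hN _ cx; have := hN _ cy; lra.
rewrite normrM -NE (_ : 2 * eta * N ^+ 2 = (N * eta) * (2 * N)); last by ring.
by rewrite ler_pM.
Qed.

Lemma sum_dot_near S xs (z : 'I_n -> 'cV[R]_2) u (eta : R) : (2 < #|S|)%N -> Pi S z ->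
  (forall i, circle (xs i)) -> {in S, forall i, d (xs i) (z i) <= eta} ->
  `|\sum_(i in S) dot u (xs i) ^+ 2 - #|S|%:R / 2 * dot u u|
    <= #|S|%:R * (2 * eta * dot u u).
Proof.
move=> S2 Pz cx h; rewrite -(sum_dot_Pi _ _ S2 Pz) -sumrB mulr_natl -sumr_const.
apply: le_trans (ler_norm_sum _ _ _) _; apply: ler_sum => i iS.
by rewrite -expr2; apply: dot_sqrB_le (h _ iS); [exact: cx|exact: circle_Pi Pz iS].
Qed.

Lemma sumr_setI_setC (S S' : {set 'I_n}) (F : 'I_n -> R) : S' \subset ~: S ->
  \sum_(i in ~: S :&: ~: S') F i =
  \sum_(i in [set: 'I_n]%SET) F i - \sum_(i in S) F i - \sum_(i in S') F i.
Proof.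
move=> sub; rewrite [\sum_(i in [set: 'I_n]%SET) _](big_setID S) /= finset.setTI finset.setTD [\sum_(i in ~: S) F i](big_setID S') /=.
rewrite (finset.setIidPr sub) finset.setDE; ring.
Qed.

(* Isotropy of S, S' and of the whole family makes the points outside S and S'
   isotropic as well, so they control the operator V - W. *)
Lemma ortho_close S S' xs y z z' V W (eta del : R) :
  (2 < #|S|)%N -> #|S'| = #|S| -> n = (4 * #|S|)%N -> S' \subset ~: S ->
  (forall i, circle (xs i)) ->
  Pi [set: 'I_n] y -> (forall i, d (xs i) (y i) <= eta) ->
  Pi S z -> {in S, forall i, d (xs i) (z i) <= eta} ->
  Pi S' z' -> {in S', forall i, d (xs i) (z' i) <= eta} ->
  eta <= 1 / 24 -> orthogonal_group V -> orthogonal_group W ->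
  {in ~: S :&: ~: S', forall i, d (V *m xs i) (W *m xs i) <= del} -> 0 <= del ->
  forall x, circle x -> d (V *m x) (W *m x) <= 16 * del.
Proof.
move=> S2 SS nE sub cx Py hy Pz hz Pz' hz' eta1 oV oW hT del0 x cx'.
set k : R := #|S|%:R; have k0 : 0 < k by rewrite ltr0n; case: #|S| S2.
pose u (a : 'I_2) : 'cV[R]_2 := \col_b (V a b - W a b).
have uE a v : (V *m v - W *m v) a 0 = dot (u a) v.
  by rewrite !mxE !sum_ord2 /dot !mxE; ring.
have nsqE v : dot (V *m v - W *m v) (V *m v - W *m v) = dot (u 0) v ^+ 2 + dot (u 1) v ^+ 2.
  by rewrite {1}/dot !uE !expr2.
(* Up to the factor [dot (u a) (u a)], the whole family gives 2k and each of [S], [S'] takes away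
   k/2. The errors add up to 2 eta (4k + k + k) = 12 k eta, at most k/2 when eta <= 1/24. *)
have low a : k / 2 * dot (u a) (u a) <= \sum_(i in ~: S :&: ~: S') dot (u a) (xs i) ^+ 2.
  have cT : #|[set: 'I_n]%SET| = n by rewrite cardsT card_ord.
  have hST : (2 < #|[set: 'I_n]%SET|)%N by rewrite cT nE; lia.
  have := sum_dot_near (u a) hST Py cx (fun i _ => hy i).
  have := sum_dot_near (u a) S2 Pz cx hz.
  have S2' : (2 < #|S'|)%N by rewrite SS.
  have := sum_dot_near (u a) S2' Pz' cx hz'.
  rewrite SS cT sumr_setI_setC // -/k.
  have -> : n%:R = 4 * k :> R by rewrite {1}nE natrM.
  have : k * (dot (u a) (u a) * (1 / 24 - eta)) >= 0.
    by rewrite mulr_ge0 ?(ltW k0) // mulr_ge0 ?dot_ge0 // subr_ge0.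
  by rewrite !ler_norml; lra.
have cardT : #|~: S :&: ~: S'| = (2 * #|S|)%N.
  rewrite -finset.setCU cardsCs finset.setCK cardsU (_ : S :&: S' = finset.set0); last first.
    by apply/eqP; rewrite finset.setI_eq0 disjoint_sym finset.disjoints_subset.
  by rewrite cards0 subn0 SS card_ord {1}nE; lia.
have up : \sum_(i in ~: S :&: ~: S') (dot (u 0) (xs i) ^+ 2 + dot (u 1) (xs i) ^+ 2) <= 2 * k * del ^+ 2.
  have -> : 2 * k * del ^+ 2 = \sum_(i in ~: S :&: ~: S') del ^+ 2.
    by rewrite sumr_const cardT -(mulr_natl (del ^+ 2)) natrM.
  apply: ler_sum => i iT; rewrite -nsqE.
  have c1 := circle_ortho oV (cx i); have c2 := circle_ortho oW (cx i).
  apply: le_trans (dot_sub_le c1 c2) _.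
  by rewrite lerXn2r ?nnegrE // ?hT //; have /andP[] := d_itv c1 c2.
have fro : dot (u 0) (u 0) + dot (u 1) (u 1) <= 4 * del ^+ 2.
  rewrite -(ler_pM2l k0); rewrite big_split /= in up.
  by have := low 0; have := low 1; lra.
have c1 := circle_ortho oV cx'; have c2 := circle_ortho oW cx'.
have /andP[d0 _] := d_itv c1 c2.
(* The factor 16 is the square root of 64 * 4: chord to arc, then the Frobenius bound [fro]. *)
rewrite -(@ler_pXn2r _ 2) // ?nnegrE ?mulr_ge0 //.
apply: le_trans (d_sq_le c1 c2) _; rewrite nsqE.
have := dot_sqr_le (u 0) x; have := dot_sqr_le (u 1) x.
by rewrite (circleE cx') !mulr1; lra.
Qed.

(** The competitor U U'^T aligns the two localizations within 2 kap, hence so does [Qh]. Then [U]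
    and Qh U' differ by at most 4 kap on the common points, by at most 16 * 4 kap everywhere by
    [ortho_close], and one more kap accounts for the localization itself. *)
Lemma refine S S' xs y z z' (x2 x2' : 'I_n -> 'cV[R]_2) U U' (Qh : 'M[R]_2) (eta kap : R) :
  (2 < #|S|)%N -> #|S'| = #|S| -> n = (4 * #|S|)%N -> S' \subset ~: S ->
  (forall i, circle (xs i)) ->
  Pi [set: 'I_n] y -> (forall i, d (xs i) (y i) <= eta) ->
  Pi S z -> {in S, forall i, d (xs i) (z i) <= eta} ->
  Pi S' z' -> {in S', forall i, d (xs i) (z' i) <= eta} ->
  eta <= 1 / 24 -> orthogonal_group U -> orthogonal_group U' -> 0 <= kap ->
  (forall i, i \notin S -> circle (x2 i)) -> (forall i, i \notin S' -> circle (x2' i)) ->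
  (forall i, i \notin S -> d (x2 i) (U *m xs i) <= kap) ->
  (forall i, i \notin S' -> d (x2' i) (U' *m xs i) <= kap) ->
  argmin (@orthogonal_group R)
    (fun Q => dinf (~: S :&: ~: S') x2 (fun i => Q *m x2' i)) Qh ->
  forall j, d (if j \in S then Qh *m x2' j else x2 j) (U *m xs j) <= 65 * kap.
Proof.
move=> S2 SS nE sub cx Py hy Pz hz Pz' hz' eta1 oU oU' kap0 c2 c2' h2 h2' [oQ Qmin] j.
have TP i : i \in ~: S :&: ~: S' -> i \notin S /\ i \notin S' by rewrite !inE => /andP[].
have oUU : orthogonal_group (U *m U'^T) by apply: ortho_mul => //; exact: ortho_trmx.
have Qle : dinf (~: S :&: ~: S') x2 (fun i => Qh *m x2' i) <= 2 * kap.
  apply: le_trans (Qmin _ oUU) _; apply: dinf_le; first by rewrite mulr_ge0.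
  move=> i /TP[iS iS'].
  apply: le_trans (@d_triangle _ (U *m xs i) _ _ _ _ _) _; [exact: c2|exact: circle_ortho|exact/circle_ortho/c2'|].
  have -> : 2 * kap = kap + kap by ring.
  apply: lerD; first exact: h2.
  have -> : U *m xs i = (U *m U'^T) *m (U' *m xs i).
    by rewrite -mulmxA ortho_Ktr.
  by rewrite d_ortho // ?[d (U' *m _) _]d_sym ?h2' //; [exact: circle_ortho|exact: c2'].
have h4 : {in ~: S :&: ~: S', forall i, d (U *m xs i) ((Qh *m U') *m xs i) <= 4 * kap}.
  move=> i iT; have [iS iS'] := TP _ iT.
  have q2 := circle_ortho oQ (c2' _ iS').
  have q3 := circle_ortho (ortho_mul oQ oU') (cx i).
  apply: le_trans (@d_triangle _ (x2 i) _ _ _ (c2 _ iS) q3) _; first exact: circle_ortho.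
  have := @d_triangle _ (Qh *m x2' i) _ _ (c2 _ iS) q2 q3.
  have -> : d (Qh *m x2' i) (Qh *m U' *m xs i) = d (x2' i) (U' *m xs i).
    by rewrite -mulmxA (d_ortho oQ (c2' _ iS') (circle_ortho oU' (cx i))).
  have := h2 _ iS; have := h2' _ iS'; have := le_trans (dinf_ge _ _ iT) Qle.
  by rewrite /= (d_sym (U *m _)); lra.
have k4 : 0 <= 4 * kap by rewrite mulr_ge0.
have := ortho_close S2 SS nE sub cx Py hy Pz hz Pz' hz' eta1 oU (ortho_mul oQ oU') h4 k4 (cx j).
case: (boolP (j \in S)) => jS; last by have := h2 _ jS; lra.
have jS' : j \notin S' by apply/negP => /(fintype.subsetP sub); rewrite inE jS.
move=> h16.
have q2 := circle_ortho oQ (c2' _ jS').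
have q3 := circle_ortho (ortho_mul oQ oU') (cx j).
apply: le_trans (@d_triangle _ ((Qh *m U') *m xs j) _ _ q2 q3 (circle_ortho oU (cx j))) _.
have -> : d (Qh *m x2' j) (Qh *m U' *m xs j) = d (x2' j) (U' *m xs j).
  by rewrite -mulmxA (d_ortho oQ (c2' _ jS') (circle_ortho oU' (cx j))).
by have := h2' _ jS'; rewrite (d_sym _ (U *m _)); lra.
Qed.

(* The rank of [s i] among the values of [s] on S serves as the grid index. *)
Lemma Pi_of_discrepancy S y s (K : R) : (0 < #|S|)%N -> n = (4 * #|S|)%N ->
  (forall i, (s i < n)%N) -> injective s -> (forall i, y i = gridpt R n (s i)) ->
  (forall t, (t <= n)%N -> `|#|[set i in S | (s i < t)%N]|%:R - t%:R / 4| <= K) ->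
  exists2 z, Pi S z & {in S, forall i, d (y i) (z i) <= 2 * pi / #|S|%:R * K}.
Proof.
move=> S0 nE sn sI yE hK.
pose r i := #|[set j in S | (s j < s i)%N]|.
have r_lt i i' : i \in S -> (s i < s i')%N -> (r i < r i')%N.
  move=> iS ii'; apply: proper_card; apply/properP; split.
    by apply/fintype.subsetP => j; rewrite !inE => /andP[-> h]; exact: ltn_trans h ii'.
  by exists i; rewrite !inE iS ?ltnn.
exists (fun i => gridpt R #|S| (r i)).
  exists r; split => //.
    move=> i iS; apply: proper_card; apply/properP; split.
      by apply/fintype.subsetP => j; rewrite !inE => /andP[].
    by exists i => //; rewrite !inE ltnn andbF.
  move=> i i' iS i'S; case: (ltngtP (s i) (s i')) => [h|h|/sI//] E.
    by have := r_lt _ _ iS h; rewrite E ltnn.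
  by have := r_lt _ _ i'S h; rewrite E ltnn.
move=> i iS; rewrite yE; apply: le_trans (d_expi_le _ _) _.
have k0 : 0 < #|S|%:R :> R by rewrite ltr0n.
have -> : 2 * pi * (s i)%:R / n%:R - 2 * pi * (r i)%:R / #|S|%:R =
  2 * pi / #|S|%:R * ((s i)%:R / 4 - (r i)%:R) :> R.
  have -> : n%:R = 4 * #|S|%:R :> R by rewrite {1}nE natrM.
  by field; rewrite gt_eqF.
have c0 : 0 <= 2 * pi / #|S|%:R :> R by rewrite divr_ge0 ?mulr_ge0 ?pi_ge0 // ltW.
by rewrite normrM (ger0_norm c0) ler_wpM2l // distrC hK // ltnW.
Qed.

End refinement.

(** * Concentration of a uniform subset *)

(* C(n, j) 3^(n - j) is largest at j = n/4: a Bernoulli(1/4) sample has the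
   cardinality n/4 with probability at least 1/(n + 1), so the exponential
   moments of independent sampling control those of a uniform n/4-subset. *)
Lemma expn4_le_bin n k : n = (4 * k)%N -> (4 ^ n <= n.+1 * ('C(n, k) * 3 ^ (n - k)))%N.
Proof.
move=> nk; pose T j := ('C(n, j) * 3 ^ (n - j))%N.
(* The ratio T (j + 1) / T j = (n - j) / (3 (j + 1)) is at least 1 for j < k and at most 1
   afterwards, as n = 4 k. *)
have step j : (j < n)%N -> (3 * j.+1 * T j.+1 = (n - j) * T j)%N.
  move=> jn; rewrite /T (_ : n - j = (n - j.+1).+1)%N ?expnS; last by lia.
  have := mul_bin_left n j; nia.
have up j : (j < k)%N -> (T j <= T j.+1)%N.
  move=> jk; have := step j ltac:(lia); move: (T j) (T j.+1) => a b; nia.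
have down j : (k <= j)%N -> (j < n)%N -> (T j.+1 <= T j)%N.
  move=> kj jn; have := step j jn; move: (T j) (T j.+1) => a b; nia.
have top j : (j <= n)%N -> (T j <= T k)%N.
  move=> jn; case: (leqP j k) => jk.
    rewrite -(subKn jk); elim: (k - j)%N => [|i IH]; first by rewrite subn0.
    case: (leqP k i) => ik.
      by rewrite (_ : k - i.+1 = k - i)%N; [exact: IH|lia].
    apply: leq_trans IH; rewrite (_ : k - i = (k - i.+1).+1)%N; last by lia.
    by apply: up; lia.
  rewrite -(subnKC (ltnW jk)) in jn *; elim: (j - k)%N jn => [|i IH] jn; first by rewrite addn0.
  apply: leq_trans (IH _); last by lia.
  by rewrite addnS; apply: down; lia.
rewrite (_ : 4 = 3 + 1)%N // expnDn.
apply: (@leq_trans (\sum_(i < n.+1) T k)); last by rewrite sum_nat_const card_ord.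
by apply: leq_sum => i _; rewrite exp1n muln1; apply: top; rewrite -ltnS.
Qed.

Section concentration.
Variable R : realType.

Lemma expR_le_quad (x : R) : x <= 1 / 2 -> expR x <= 1 + x + 2 * x ^+ 2.
Proof.
move=> x2; have h := expR_ge1Dx (- x); rewrite expRN in h.
have e0 := expR_gt0 x.
have x1 : 0 < 1 - x by lra.
have : expR x * (1 - x) <= 1 by rewrite -ler_pdivlMl // mulr1; lra.
rewrite -ler_pdivlMr // div1r => h1; apply: le_trans h1 _.
rewrite -[leLHS]div1r ler_pdivrMr // -subr_ge0.
have -> : (1 + x + 2 * x ^+ 2) * (1 - x) - 1 = x ^+ 2 * (1 - 2 * x) by ring.
by rewrite mulr_ge0 ?sqr_ge0 //; lra.
Qed.

(** Four times the exponential moment of a centred Bernoulli(1/4) variable. In the quadratic bounds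
    the linear terms cancel and the squares add up to 3/2 l^2 = 4 * 3/8 l^2. *)
Lemma mgf_bernoulli_quarter (l : R) : `|l| <= 1 / 2 ->
  (3 + expR l) * expR (- (l / 4)) <= 4 * expR (3 / 8 * l ^+ 2).
Proof.
rewrite ler_norml => /andP[l1 l2].
have -> : (3 + expR l) * expR (- (l / 4)) = 3 * expR (- (l / 4)) + expR (3 / 4 * l).
  rewrite mulrDl -expRD; congr (_ + expR _); lra.
have e1 := @expR_le_quad (- (l / 4)) ltac:(lra).
have e2 := @expR_le_quad (3 / 4 * l) ltac:(lra).
have e3 := expR_ge1Dx (3 / 8 * l ^+ 2).
lra.
Qed.

Section draws.
Variable n : nat.
Implicit Types S U : {set 'I_n}.

Lemma card_setI_sum S U : #|S :&: U| = (\sum_(i in S) (i \in U))%N.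
Proof.
rewrite -sum1_card (eq_bigl (fun i => (i \in S) && (i \in U))); last by move=> i; rewrite inE.
by rewrite big_mkcondr; apply: eq_bigr => i _; case: (i \in U).
Qed.

(** The product of the a_i + 3 expands over all subsets as independent sampling with odds 1 to 3;
    the k-subsets form part of a sum of nonnegative terms. *)
Lemma sum_draws_expR U (l : R) (k : nat) : (k <= n)%N ->
  3 ^+ (n - k) * \sum_(S : {set 'I_n} | #|S| == k) expR (l * #|S :&: U|%:R)
  <= (3 + expR l) ^+ #|U| * 4 ^+ (n - #|U|).
Proof.
move=> kn.
pose a (i : 'I_n) : R := if i \in U then expR l else 1.
have prodE : \prod_(i < n) (a i + 3) = (3 + expR l) ^+ #|U| * 4 ^+ (n - #|U|).
  rewrite (bigID (mem U)) /=; congr (_ * _).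
    rewrite -prodr_const; apply: eq_bigr => i iU.
    by rewrite /a (_ : i \in U) // addrC.
  rewrite (_ : n - #|U| = #|~: U|)%N; last first.
    by rewrite [#|~: U|]cardsCs finset.setCK card_ord.
  rewrite -prodr_const; apply: eq_big => [i|i iU]; first by rewrite inE.
  rewrite /a (_ : (i \in U) = false); last exact: negbTE.
  by rewrite -(natrD _ 1 3).
rewrite -prodE bigA_distr [leRHS](bigID (fun S : {set 'I_n} => #|S| == k)) /= mulr_sumr.
have wE (S : {set 'I_n}) : \prod_i (if i \in S then a i else 3) =
    3 ^+ (n - #|S|) * expR (l * #|S :&: U|%:R).
  rewrite (bigID (mem S)) /= mulrC; congr (_ * _).
    rewrite (_ : n - #|S| = #|~: S|)%N; last first.
      by rewrite [#|~: S|]cardsCs finset.setCK card_ord.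
    rewrite -prodr_const; apply: eq_big => [i|i iS]; first by rewrite inE.
    by rewrite (negbTE iS).
  rewrite card_setI_sum natr_sum mulr_sumr expR_sum; apply: eq_bigr => i iS.
  by rewrite iS /a; case: (i \in U); rewrite ?mulr1 ?mulr0 ?expR0.
rewrite -[leLHS]addr0 lerD //.
  by apply: ler_sum => S /eqP SE; rewrite wE SE.
apply: sumr_ge0 => S _; rewrite wE mulr_ge0 ?expR_ge0 // exprn_ge0.
Qed.

(** Fixing the cardinality at its mean k costs only the factor n + 1 of [expn4_le_bin]. *)
Lemma sum_draws_dev U (l : R) (k : nat) : n = (4 * k)%N -> `|l| <= 1 / 2 ->
  \sum_(S : {set 'I_n} | #|S| == k) expR (l * (#|S :&: U|%:R - #|U|%:R / 4))
  <= n.+1%:R * 'C(n, k)%:R * expR (3 / 8 * l ^+ 2 * n%:R).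
Proof.
move=> nE l2; set t := #|U|.
have tn : (t <= n)%N by rewrite -[leqRHS]card_ord max_card.
have kn : (k <= n)%N by lia.
have p3 : 0 < 3 ^+ (n - k) :> R by rewrite exprn_gt0.
rewrite -(ler_pM2l p3).
have -> : \sum_(S : {set 'I_n} | #|S| == k) expR (l * (#|S :&: U|%:R - t%:R / 4)) =
   (\sum_(S : {set 'I_n} | #|S| == k) expR (l * #|S :&: U|%:R)) * expR (- (l / 4)) ^+ t.
  rewrite mulr_suml; apply: eq_bigr => S _; rewrite -expRM_natr -expRD; congr expR; lra.
rewrite mulrA; apply: le_trans (ler_wpM2r _ (sum_draws_expR U l kn)) _.
  by rewrite exprn_ge0 // expR_ge0.
rewrite -/t mulrAC -exprMn.
apply: le_trans (_ : (4 * expR (3 / 8 * l ^+ 2)) ^+ t * 4 ^+ (n - t) <= _).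
  rewrite ler_wpM2r ?exprn_ge0 // lerXn2r ?nnegrE ?mulr_ge0 ?addr_ge0 ?expR_ge0 //.
  exact: mgf_bernoulli_quarter.
rewrite exprMn mulrAC -exprD subnKC // -expRM_natr.
have h4 : 4 ^+ n <= n.+1%:R * ('C(n, k)%:R * 3 ^+ (n - k)) :> R.
  rewrite -!natrX -!natrM ler_nat.
  exact: (expn4_le_bin nE).
have e1 : expR (3 / 8 * l ^+ 2 * t%:R) <= expR (3 / 8 * l ^+ 2 * n%:R).
  by rewrite ler_expR ler_wpM2l ?ler_nat // mulr_ge0 ?sqr_ge0 //; lra.
apply: le_trans (ler_pM _ _ h4 e1) _; rewrite ?exprn_ge0 ?expR_ge0 //.
by rewrite le_eqVlt; apply/orP; left; apply/eqP; ring.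
Qed.

Lemma card_draws_dev U (l K : R) (k : nat) : n = (4 * k)%N -> 0 <= l <= 1 / 2 ->
  #|[set S : {set 'I_n} | (#|S| == k) && (K < `| #|S :&: U|%:R - #|U|%:R / 4|)]%SET|%:R
  <= 2 * (n.+1%:R * 'C(n, k)%:R) * expR (3 / 8 * l ^+ 2 * n%:R - l * K) :> R.
Proof.
move=> nE /andP[l0 l2].
have nl : `|l| <= 1 / 2 by rewrite ger0_norm.
have nl' : `|- l| <= 1 / 2 by rewrite normrN.
have h1 := sum_draws_dev U nE nl; have h2 := sum_draws_dev U nE nl'.
rewrite sqrrN in h2; rewrite expRB.
rewrite mulrA ler_pdivlMr ?expR_gt0 //.
(* Markov's inequality for both signs at once: on a deviating subset one of the two exponentials
   exceeds expR (l K). *)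
apply: le_trans (_ : \sum_(S : {set 'I_n} | #|S| == k)
   (expR (l * (#|S :&: U|%:R - #|U|%:R / 4)) + expR (- l * (#|S :&: U|%:R - #|U|%:R / 4))) <= _); last first.
  by rewrite big_split /=; lra.
rewrite -sum1_card natr_sum mulr_suml big_mkcond [leRHS]big_mkcond.
apply: ler_sum => S _; rewrite inE; case: ifP => [/andP[-> ]|_]; last first.
  by case: ifP => // _; rewrite addr_ge0 ?expR_ge0.
rewrite mul1r.
set y : R := _%:R - _ / 4 => Ky.
have [y0|y0] := lerP 0 y.
  by rewrite ger0_norm // in Ky; rewrite -[leLHS]addr0 lerD ?expR_ge0 // ler_expR ler_wpM2l // ltW.
rewrite ltr0_norm // in Ky.
by rewrite -[leLHS]add0r lerD ?expR_ge0 // ler_expR mulNr -mulrN ler_wpM2l // ltW.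
Qed.

(** Some initial segment of the order [s], that is some arc starting at angle 0, does not receive
    its quarter share up to [K]. Arcs up to the full circle are included. *)
Definition unbalanced (s : 'I_n -> nat) (K : R) S : bool :=
  [exists t : 'I_n.+1, K < `| #|S :&: [set i | (s i < t)%N]%SET|%:R - t%:R / 4|].

Lemma card_unbalanced (s : 'I_n -> nat) (k : nat) : (1 < n)%N -> n = (4 * k)%N ->
  (forall i, (s i < n)%N) -> injective s -> rate R n <= 1 / 2 ->
  #|[set S : {set 'I_n} | (#|S| == k) && unbalanced s (10 * n%:R * rate R n) S]%SET|%:R
  <= 'C(n, k)%:R / n%:R ^+ 2 :> R.
Proof.
move=> n1 nE sn sI r2; set r := rate R n in r2 *; set K := 10 * n%:R * r.
have n0 : 0 < n%:R :> R by rewrite ltr0n; lia.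
have r0 : 0 <= r by exact: sqrtr_ge0.
have rE : n%:R * r ^+ 2 = ln n%:R.
  rewrite sqr_sqrtr ?divr_ge0 ?ln_ge0 ?ler1n ?ler0n //; try lia.
  by field; rewrite gt_eqF.
pose Ut (t : 'I_n.+1) : {set 'I_n} := [set i | (s i < t)%N]%SET.
have cardU t : #|Ut t| = t.
  rewrite -sum1_card (eq_bigl (fun i : 'I_n => (s i < t)%N)); last by move=> i; rewrite inE.
  rewrite big_mkcond /=.
  have sS : {in [set: 'I_n]%SET, forall i, (s i < #|[set: 'I_n]%SET|)%N}.
    by move=> i _; rewrite cardsT card_ord.
  have := sum_inj_card (fun j => if (j < t)%N then 1%N else 0%N) sS (fun i j _ _ => @sI i j).
  have -> : (\sum_(i in [set: 'I_n]%SET) (if s i < t then 1 else 0) =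
      \sum_(i : 'I_n) (if s i < t then 1 else 0))%N by apply: eq_bigl => i; rewrite inE.
  move=> ->; rewrite cardsT card_ord -big_mkcond /=.
  have tn : (t <= n)%N by rewrite -ltnS.
  by rewrite -(big_nat_widen 0 t n xpredT (fun=> 1%N) tn) sum_nat_const_nat subn0 muln1.
pose Bt t := [set S : {set 'I_n} | (#|S| == k) && (K < `| #|S :&: Ut t|%:R - #|Ut t|%:R / 4|)]%SET.
have sub : #|[set S : {set 'I_n} | (#|S| == k) && unbalanced s K S]%SET|%:R <=
   \sum_(t < n.+1) #|Bt t|%:R :> R.
  rewrite -natr_sum ler_nat.
  have E (t : 'I_n.+1) : #|Bt t| = (\sum_(S : {set 'I_n}) (S \in Bt t))%N.
    by rewrite -sum1_card big_mkcond; apply: eq_bigr => S _; case: (S \in Bt t).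
  rewrite (eq_bigr _ (fun t _ => E t)) exchange_big -sum1_card big_mkcond /=.
  apply: leq_sum => S _; case: ifP => //; rewrite inE => /andP[Sk /existsP[t ht]].
  by rewrite (bigD1 t) //= inE Sk cardU ht.
apply: le_trans sub _.
have rr : 0 <= r <= 1 / 2 by rewrite r0.
apply: le_trans (ler_sum _ (fun t _ => card_draws_dev (Ut t) K nE rr)) _.
rewrite sumr_const card_ord -[_ *+ n.+1]mulr_natl.
have L0 : 0 <= ln n%:R :> R by rewrite ln_ge0 // ler1n; lia.
(* With l = r and K = 10 n r the exponent is (3/8 - 10) ln n = - 77/8 ln n, below - 9 ln n. The
   excess powers absorb the factor 2 (n + 1)^2 <= 8 n^2 from the two signs, the n + 1 segments and
   the fixed cardinality. *)
have e9 : expR (3 / 8 * r ^+ 2 * n%:R - r * K) <= (n%:R ^+ 9)^-1.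
  have -> : 3 / 8 * r ^+ 2 * n%:R - r * K = - (77 / 8 * ln n%:R) by rewrite /K -rE; field.
  rewrite expRN lef_pV2 ?posrE ?exprn_gt0 ?expR_gt0 //.
  rewrite -{1}(@lnK R n%:R) ?posrE // -expRM_natl ler_expR ler_wpM2r //; lra.
have n2 : 2 <= n%:R :> R by rewrite (ler_nat R 2).
have C0 : 0 <= 'C(n, k)%:R :> R by rewrite ler0n.
apply: le_trans (_ : 8 * n%:R ^+ 2 * 'C(n, k)%:R * (n%:R ^+ 9)^-1 <= _).
  rewrite [leLHS]mulrA ler_pM ?expR_ge0 ?mulr_ge0 //.
  rewrite (_ : n.+1%:R * (2 * (n.+1%:R * 'C(n, k)%:R)) = 2 * (n%:R + 1) ^+ 2 * 'C(n, k)%:R).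
    by rewrite ler_wpM2r //; nra.
  by rewrite -natr1; ring.
rewrite (_ : _ * _ = 'C(n, k)%:R / n%:R ^+ 2 * (8 / n%:R ^+ 5)); last first.
  by field; rewrite gt_eqF.
rewrite ler_piMr // ?divr_ge0 ?exprn_ge0 // ler_pdivrMr ?exprn_gt0 // mul1r.
apply: le_trans (_ : 2 ^+ 5 <= _); first by rewrite -natrX ler_nat.
by rewrite lerXn2r ?nnegrE // ler0n.
Qed.

End draws.
End concentration.

(** * Noise events *)

Section union_bound.
Context d (T : measurableType d) (R : realType) (mu : {measure set T -> \bar R}).

Lemma exists_bigsetU (I : finType) (Q : pred I) (B : I -> set T) :
  [set w | exists2 i, Q i & B i w] = \big[setU/set0]_(i | Q i) B i.
Proof.
rewrite -bigcup_seq_cond; apply/seteqP; split => w [i Qi Bi]; exists i => //=.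
  by rewrite mem_index_enum.
by move: Qi => /= /andP[].
Qed.

Lemma union_bound (I : finType) (Q : pred I) (B : I -> set T) (c : I -> \bar R) :
  (forall i, Q i -> measurable (B i)) ->
  (forall i, Q i -> (mu (B i) <= c i)%E) ->
  measurable [set w | exists2 i, Q i & B i w] /\
  (mu [set w | exists2 i, Q i & B i w] <= \sum_(i | Q i) c i)%E.
Proof.
move=> mB Bc; rewrite exists_bigsetU.
apply: (@big_ind2 (set T) (\bar R) (fun X s => measurable X /\ (mu X <= s)%E)).
- by rewrite measure0.
- move=> X s Y t [mX Xs] [mY Yt]; split; first exact: measurableU.
  by apply: le_trans (measureU2 _ mX mY) _; exact: leeD.
- by move=> i Qi; split; [exact: mB|exact: Bc].
Qed.

Lemma measure_disjoint_sum_le (I : finType) (Q : pred I) (B : I -> set T) :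
  (forall i, Q i -> measurable (B i)) ->
  (forall i j w, Q i -> Q j -> B i w -> B j w -> i = j) ->
  (\sum_(i | Q i) mu (B i) <= mu setT)%E.
Proof.
move=> mB dB.
have E : [set` enum Q] = [set i | Q i] by apply/seteqP; split => i /=; rewrite mem_enum.
have fin : finite_set [set i | Q i] by rewrite -E; exact: finite_seq.
have triv : trivIset [set i | Q i] B.
  by move=> i j Qi Qj [w [Bi Bj]]; exact: dB Bi Bj.
have H := measure_fin_bigcup mu fin triv mB.
rewrite -big_enum /= fsbig_seq ?enum_uniq // E -H le_measure // ?inE //.
by apply: fin_bigcup_measurable.
Qed.

Lemma measurable_gt (f : T -> R) (t : R) : measurable_fun setT f ->
  measurable [set w | t < f w].
Proof.
move=> mf; rewrite (_ : [set w | _] = setT `&` f @^-1` `]t, +oo[); first exact: mf.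
by rewrite setTI; apply/seteqP; split => w /=; rewrite in_itv /= andbT.
Qed.

End union_bound.

Section noise.
Context d (T : measurableType d) (R : realType) (P : probability T R) (n : nat).
Variables (F : 'M[R]_n) (E : 'I_n -> 'I_n -> {RV P >-> R}) (A : T -> 'M[R]_n).
Hypotheses (hF : F^T = F) (hA : forall w, (A w)^T = A w) (hA0 : forall w i, A w i i = 0)
  (hE : forall w (i j : 'I_n), (i < j)%N -> A w i j = F i j + E i j w)
  (hG : subGaussian1 P (fun i j => E i j)).
Implicit Types C : 'I_n -> 'I_n -> R.

Lemma sum_offdiag (X : 'I_n -> 'I_n -> R) : (forall i, X i i = 0) ->
  \sum_i \sum_j X i j = \sum_(i < n) \sum_(j < n | (i < j)%N) (X i j + X j i).
Proof.
move=> X0; under [RHS]eq_bigr do rewrite big_split.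
rewrite big_split /= [X in _ + X](exchange_big_dep xpredT) //= -big_split /=.
apply: eq_bigr => i _; rewrite (bigID (fun j : 'I_n => (i < j)%N)) /=; congr (_ + _).
rewrite [LHS](bigD1 i) /=; last by rewrite ltnn.
by rewrite X0 add0r; apply: eq_bigl => j; rewrite -leqNgt [RHS]ltn_neqAle andbC.
Qed.

Lemma A_sym w i j : A w i j = A w j i.
Proof. by rewrite -[in LHS](hA w) mxE. Qed.

Lemma F_sym i j : F i j = F j i.
Proof. by rewrite -[in LHS]hF mxE. Qed.

Lemma measurable_entry i j : measurable_fun setT (fun w => A w i j).
Proof.
case: (ltngtP i j) => [ij|ji|/val_inj <-].
- rewrite (_ : (fun w => _) = (fun w => F i j + E i j w)); last by apply/funext => w; exact: hE.
  by apply: measurable_funD => //; exact: measurable_cst.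
- rewrite (_ : (fun w => _) = (fun w => F j i + E j i w)); last first.
    by apply/funext => w; rewrite A_sym hE.
  by apply: measurable_funD => //; exact: measurable_cst.
- rewrite (_ : (fun w => _) = (fun=> 0)); first exact: measurable_cst.
  by apply/funext => w; rewrite hA0.
Qed.

Definition noise C w : R := \sum_i \sum_j C i j * (A w i j - F i j).

(** The factor 2 comes from the symmetry of [A]: the variable E i j carries C i j + C j i, whose
    square is at most twice the sum of the squares. *)
Definition noise_exceeds C (t : R) : set T :=
  [set w | t * Num.sqrt (2 * \sum_i \sum_j C i j ^+ 2) < noise C w].

Lemma measurable_noise_exceeds C t : measurable (noise_exceeds C t).
Proof.
apply: measurable_gt; apply: measurable_sum => i; apply: measurable_sum => j.
apply: measurable_funM; first exact: measurable_cst.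
by apply: measurable_funB; [exact: measurable_entry|exact: measurable_cst].
Qed.

(** Zero coefficients on the diagonal are required because A i i - F i i is not a noise variable. *)
Lemma noise_exceeds_le C t : (forall i, C i i = 0) -> 0 <= t ->
  (P (noise_exceeds C t) <= (expR (- (t ^+ 2) / 2))%:E)%E.
Proof.
move=> C0 t0; pose B : 'M[R]_n := \matrix_(i, j) (C i j + C j i).
apply: le_trans (hG B t0); apply: le_measure; [apply/mem_set|apply/mem_set|].
- exact: measurable_noise_exceeds.
- apply: measurable_gt; apply: measurable_sum => i.
  under eq_fun do rewrite big_mkcond /=.
  apply: measurable_sum => j; case: (i < j)%N; last exact: measurable_cst.
  by apply: measurable_funM => //; exact: measurable_cst.
- move=> w; rewrite /noise_exceeds /= => h.
  have -> : \sum_(i < n) \sum_(j < n | (i < j)%N) B i j * E i j w = noise C w.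
    rewrite /noise sum_offdiag; last by move=> i; rewrite C0 mul0r.
    apply: eq_bigr => i _; apply: eq_bigr => j ij.
    by rewrite mxE (A_sym w j) (F_sym j) hE //; ring.
  apply: le_lt_trans h; rewrite ler_wpM2l // ler_wsqrtr //.
  rewrite sum_offdiag; last by move=> i; rewrite C0 expr0n.
  rewrite mulr_sumr; apply: ler_sum => i _; rewrite mulr_sumr; apply: ler_sum => j _.
  rewrite mxE -subr_ge0 (_ : _ - _ = (C i j - C j i) ^+ 2) ?sqr_ge0 //.
  by ring.
Qed.

Section independence.
Variables (S : T -> {set 'I_n}) (x1 : T -> 'I_n -> 'cV[R]_2).
Hypotheses (mS : forall s, measurable (S @^-1` [set s])) (mx : measurable_tuple x1)
  (hties : ties_from_block P A S x1).
Variables (s : {set 'I_n}) (v : 'I_n -> 'cV[R]_2).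

Definition draw := [set w | S w = s /\ {in s, x1 w =1 v}].

Lemma measurable_draw : measurable draw.
Proof.
rewrite (_ : draw = S @^-1` [set s] `&` \big[setI/setT]_(i | i \in s)
   ((fun w => x1 w i 0 0) @^-1` [set v i 0 0] `&` (fun w => x1 w i 1 0) @^-1` [set v i 1 0])).
  apply: measurableI => //; apply: bigsetI_measurable => i _; apply: measurableI.
    by rewrite -[X in measurable X]setTI; exact: mx.
  by rewrite -[X in measurable X]setTI; exact: mx.
rewrite -bigcap_seq_cond; apply/seteqP; split => w /=.
  by move=> [-> h]; split => // i /= /andP[_ /h ->].
move=> [Sw h]; split => // i iS.
have [h0 h1] := h i ltac:(by rewrite /= mem_index_enum).
apply/colP => k; case: k => -[|[|//]] hk.
  by rewrite (_ : Ordinal hk = 0) //; apply/val_inj.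
by rewrite (_ : Ordinal hk = 1) //; apply/val_inj.
Qed.

Let rest := entries_in A (fun i j => ~~ ((i \in s) && (j \in s))).
Let boxes : set (set T) :=
  [set X | exists2 B : 'I_n -> 'I_n -> set R, (forall i j, measurable (B i j)) & X = rest B].

Let measurable_rest B : (forall i j, measurable (B i j)) -> measurable (rest B).
Proof.
move=> mB.
rewrite (_ : rest B = \big[setI/setT]_(p : 'I_n * 'I_n | ~~ ((p.1 \in s) && (p.2 \in s)))
   ((fun w => A w p.1 p.2) @^-1` (B p.1 p.2))).
  apply: bigsetI_measurable => p _.
  by rewrite -[X in measurable X]setTI; apply: measurable_entry.
rewrite -bigcap_seq_cond; apply/seteqP; split => w /=.
  by move=> h [i j] /= /andP[_ ij]; exact: h.
by move=> h i j ij; apply: (h (i, j)); rewrite /= mem_index_enum.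
Qed.

Let draw_rest B : (forall i j, measurable (B i j)) ->
  P (draw `&` rest B) = (P draw * P (rest B))%E.
Proof.
move=> mB; pose B' i j := if (i \in s) && (j \in s) then setT else B i j.
have mB' i j : measurable (B' i j) by rewrite /B'; case: ifP.
have := hties s v mB'; rewrite /=.
have -> : entries_in A (fun i j => ~~ ((i \in s) && (j \in s))) B' = rest B.
  by apply/seteqP; split => w h i j ij; have := h i j ij; rewrite /B' (negbTE ij).
have -> : entries_in A (fun i j => (i \in s) && (j \in s)) B' = setT.
  by apply/seteqP; split => w // _ i j ij; rewrite /B' ij.
by rewrite setIT.
Qed.

(** Boxes in the entries outside s * s form a pi-system on which the finite measures X -> P (X and
    draw) and P draw * P X agree, so they agree on the generated sigma-algebra. The noise event
    belongs to it, its coefficients being zero on the block. *)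
Lemma draw_independent C t : (forall i j, i \in s -> j \in s -> C i j = 0) ->
  P (draw `&` noise_exceeds C t) = (P draw * P (noise_exceeds C t))%E.
Proof.
move=> C0.
have mD := measurable_draw.
pose r : {nonneg R} := NngNum (fine_ge0 (measure_ge0 P draw)).
have PD : P draw = r%:num%:E by rewrite /= fineK // fin_num_measure.
pose m1 := mrestr P mD; pose m2 := mscale r P.
pose H := [set X | boxes X /\ X `<=` setT].
have HE : H = boxes by apply/seteqP; split => [X []//|X bX]; split.
have Hm : H `<=` measurable by move=> X; rewrite HE => -[B mB ->]; exact: measurable_rest.
have HI : setI_closed H.
  rewrite HE => X Y [B mB ->] [B' mB' ->].
  exists (fun i j => B i j `&` B' i j); first by move=> i j; exact: measurableI.
  apply/seteqP; split => w /=.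
    by move=> [h h'] i j ij; split; [exact: h|exact: h'].
  by move=> h; split => i j ij; have [] := h i j ij.
have m12T : m1 setT = m2 setT.
  by rewrite /m1 /m2 /mrestr /mscale /= setTI probability_setT mule1.
have m12 X : H X -> m1 X = m2 X.
  rewrite HE => -[B mB ->]; rewrite /m1 /m2 /mrestr /mscale /= setIC draw_rest //.
  by rewrite PD.
have m1oo : (m1 setT < +oo)%E.
  by rewrite /m1 /mrestr /= setTI (le_lt_trans (probability_le1 P mD)) // ltry.
have uniq := g_sigma_algebra_measure_unique_trace boxes setT measurableT Hm HI
  (mrestr P mD) (mscale r P) m12T m12 m1oo (fun X _ => @subsetT _ X).
have : <<s H >> (noise_exceeds C t).
  suff : @measurable _ (g_sigma_algebraType H) (noise_exceeds C t) by [].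
  apply: (@measurable_gt _ (g_sigma_algebraType H)).
  apply: measurable_sum => i; apply: measurable_sum => j.
  case: (boolP ((i \in s) && (j \in s))) => ij.
    rewrite (_ : (fun x => _) = (fun=> 0)); first exact: measurable_cst.
    by apply/funext => w; case/andP: ij => iS jS; rewrite C0 // mul0r.
  apply: measurable_funM; first exact: measurable_cst.
  apply: measurable_funB; last exact: measurable_cst.
  move=> _ Y mY; rewrite setTI; apply: sub_sigma_algebra; rewrite HE.
  exists (fun i' j' => if (i' == i) && (j' == j) then Y else setT).
    by move=> i' j'; case: ifP.
  apply/seteqP; split => w /=.
    by move=> h i' j' _; case: ifP => // /andP[/eqP-> /eqP->].
  by move=> /(_ i j ij); rewrite !eqxx.
move=> /uniq U; rewrite setIC PD; exact: U.
Qed.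

End independence.
End noise.

(** * Exceptional events of probability at most 1/n^2 *)

Section events.
Context d (T : measurableType d) (R : realType) (P : probability T R) (n k : nat).
Hypotheses (nE : n = (4 * k)%N) (k0 : (0 < k)%N).
Implicit Types (s : {set 'I_n}) (u v : 'I_n -> 'cV[R]_2).

Let n2 : (2 <= n)%N. Proof. by rewrite nE; lia. Qed.

Let n0 : 0 < n%:R :> R. Proof. by rewrite ltr0n; lia. Qed.

Lemma rate_sqr : n%:R * rate R n ^+ 2 = ln n%:R.
Proof.
have n1 : 1 <= n%:R :> R by rewrite ler1n; lia.
rewrite sqr_sqrtr ?divr_ge0 ?ln_ge0 ?ler0n //.
by field; rewrite gt_eqF.
Qed.

Lemma expRN_natM_ln (a : nat) : expR (- (a%:R * ln n%:R)) = (n%:R ^+ a)^-1 :> R.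
Proof. by rewrite expRN expRM_natl lnK // posrE. Qed.

Definition block_coef s u v (i j : 'I_n) : R :=
  if (i \in s) && (j \in s) then Defs.d (u i) (u j) - Defs.d (v i) (v j) else 0.

(** The guard [i0 \notin s] makes the coefficients vanish on the diagonal and on the block for every
    index of the union bound, even a meaningless one. *)
Definition row_coef s (i0 : 'I_n) (y z : 'cV[R]_2) v (i j : 'I_n) : R :=
  if [&& i == i0, i0 \notin s & j \in s] then Defs.d y (v j) - Defs.d z (v j) else 0.

Variables (F : 'M[R]_n) (E : 'I_n -> 'I_n -> {RV P >-> R}) (A : T -> 'M[R]_n).
Hypotheses (hF : F^T = F) (hA : forall w, (A w)^T = A w) (hA0 : forall w i, A w i i = 0)
  (hE : forall w (i j : 'I_n), (i < j)%N -> A w i j = F i j + E i j w)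
  (hG : subGaussian1 P (fun i j => E i j)).

Lemma block_coef_diag s u v i : block_coef s u v i i = 0 \/ ~ circle (u i) \/ ~ circle (v i).
Proof.
rewrite /block_coef; case: ifP => _; last by left.
have [cu|] := pselect (circle (u i)); last by right; left.
have [cv|] := pselect (circle (v i)); last by right; right.
by left; rewrite !dxx // subrr.
Qed.

Lemma noise_block s u v w : noise F A (block_coef s u v) w =
  \sum_(i in s) \sum_(j in s) (A w i j - F i j) * (Defs.d (u i) (u j) - Defs.d (v i) (v j)).
Proof.
rewrite /noise /block_coef [RHS]big_mkcond; apply: eq_bigr => i _.
case: (i \in s) => /=; last by rewrite big1 // => j _; rewrite mul0r.
by rewrite [RHS]big_mkcond; apply: eq_bigr => j _; case: (j \in s); rewrite ?mul0r // mulrC.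
Qed.

Lemma sqr_block s u v : \sum_i \sum_j block_coef s u v i j ^+ 2 =
  \sum_(i in s) \sum_(j in s) (Defs.d (u i) (u j) - Defs.d (v i) (v j)) ^+ 2.
Proof.
rewrite /block_coef [RHS]big_mkcond; apply: eq_bigr => i _.
case: (i \in s) => /=; last by rewrite big1 // => j _; rewrite expr0n.
by rewrite [RHS]big_mkcond; apply: eq_bigr => j _; case: (j \in s); rewrite ?expr0n.
Qed.

Lemma noise_row s i y z v w : i \notin s -> noise F A (row_coef s i y z v) w =
  \sum_(j in s) (A w i j - F i j) * (Defs.d y (v j) - Defs.d z (v j)).
Proof.
move=> iS; rewrite /noise /row_coef (bigD1 i) //= [X in _ + X]big1 ?addr0.
  rewrite [RHS]big_mkcond; apply: eq_bigr => j _; rewrite eqxx iS /=.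
  by case: (j \in s); rewrite ?mul0r // mulrC.
by move=> i' /negbTE ii'; rewrite big1 // => j _; rewrite ii' mul0r.
Qed.

Lemma sqr_row s i y z v : i \notin s -> \sum_i' \sum_j row_coef s i y z v i' j ^+ 2 =
  \sum_(j in s) (Defs.d y (v j) - Defs.d z (v j)) ^+ 2.
Proof.
move=> iS; rewrite /row_coef (bigD1 i) //= [X in _ + X]big1 ?addr0.
  rewrite [RHS]big_mkcond; apply: eq_bigr => j _; rewrite eqxx iS /=.
  by case: (j \in s); rewrite ?expr0n.
by move=> i' /negbTE ii'; rewrite big1 // => j _; rewrite ii' expr0n.
Qed.

Let o : 'I_n := Ordinal (leq_trans (isT : (0 < 2)%N) n2).

Definition grid_tuple (c : {ffun 'I_n -> 'I_n}) (i : 'I_n) : 'cV[R]_2 := gridpt R k (c i).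

(** Pinning the code to the default [o] outside [s] makes it unique, so that draws with distinct
    codes are disjoint events. *)
Definition code_on s (c : {ffun 'I_n -> 'I_n}) : bool :=
  [forall i, if i \in s then (c i < k)%N else c i == o].

Lemma Pi_code s v : #|s| = k -> Pi s v ->
  exists2 c, code_on s c & {in s, v =1 grid_tuple c}.
Proof.
move=> sk [g [gs _ vE]].
have gn i : i \in s -> (g i < n)%N by move=> /gs; rewrite sk nE; lia.
have vi i : i \in s -> insubd o (g i) = g i :> nat.
  by move=> iS; apply: insubdK; exact: gn.
exists [ffun i => if i \in s then insubd o (g i) else o].
  apply/forallP => i; rewrite ffunE; case: (boolP (i \in s)) => iS //.
  by rewrite vi // -sk gs.
by move=> i iS; rewrite vE // /grid_tuple ffunE iS sk vi.
Qed.

(* A union bound over all k-subsets and all pairs of tuples costs only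
   O(n log n) in the exponent, so S may depend on A here. *)
Lemma block_noise_event : exists B : set T,
  [/\ measurable B, (P B <= (n%:R ^- 2)%:E)%E &
    forall w, ~ B w -> forall s u v, #|s| = k -> Pi s u -> Pi s v ->
      noise F A (block_coef s u v) w <= 4 * n%:R * rate R n *
        Num.sqrt (2 * \sum_i \sum_j block_coef s u v i j ^+ 2)].
Proof.
pose I := ({set 'I_n} * ({ffun 'I_n -> 'I_n} * {ffun 'I_n -> 'I_n}))%type.
pose t : R := 4 * n%:R * rate R n.
have t0 : 0 <= t by rewrite mulr_ge0 ?rate_ge0 // mulr_ge0 ?ler0n.
pose C (p : I) := block_coef p.1 (grid_tuple p.2.1) (grid_tuple p.2.2).
have C0 p i : C p i i = 0.
  by have [//|[]] := block_coef_diag p.1 (grid_tuple p.2.1) (grid_tuple p.2.2) i; case; exact: circle_gridpt.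
have [mB PB] := @union_bound _ T R P I xpredT (fun p => noise_exceeds F A (C p) t)
  (fun=> (expR (- (t ^+ 2) / 2))%:E) (fun p _ => measurable_noise_exceeds hA hA0 hE (C p) t)
  (fun p _ => noise_exceeds_le hF hA hA0 hE hG (C0 p) t0).
exists [set w | exists2 p : I, xpredT p & noise_exceeds F A (C p) t w]; split => //.
- apply: le_trans PB _; rewrite sumEFin lee_fin sumr_const.
  have -> : - (t ^+ 2) / 2 = - ((8 * n)%N%:R * ln n%:R).
    by rewrite -rate_sqr natrM /t; field.
  rewrite expRN_natM_ln -[_ *+ _]mulr_natl.
  (* At most 2^n n^n n^n <= n^(3n) cases, against a tail of n^(-8n). *)
  have cardI : (#|xpredT : pred I| <= n ^ (3 * n))%N.
    rewrite (_ : #|_| = #|{: I}|) // !card_prod card_ffun !card_ord.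
    rewrite (_ : #|{: {set 'I_n}}| = 2 ^ n)%N; last by rewrite -cardsT -powersetT card_powerset cardsT card_ord.
    rewrite -expnD (_ : 3 * n = n + (n + n))%N; last by lia.
    by rewrite [X in (_ <= X)%N]expnD leq_mul2r leq_exp2r ?n2 ?orbT //; lia.
  apply: le_trans (_ : n%:R ^+ (3 * n) * (n%:R ^+ (8 * n))^-1 <= _).
    by rewrite ler_wpM2r ?invr_ge0 ?exprn_ge0 // -natrX ler_nat.
  rewrite ler_pdivrMr ?exprn_gt0 // ler_pdivlMl ?exprn_gt0 // -exprD.
  by apply: ler_weXn2l; [rewrite ler1n; lia|lia].
- move=> w nB s u v sk Pu Pv.
  have [c cs uE] := Pi_code sk Pu; have [c' cs' vE] := Pi_code sk Pv.
  rewrite leNgt; apply/negP => h; apply: nB; exists (s, (c, c')) => //.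
  rewrite /noise_exceeds /= (_ : C _ = block_coef s u v) //.
  apply/funext => i; apply/funext => j; rewrite /C /block_coef /=.
  by case: ifP => // /andP[iS jS]; rewrite !uE // !vE.
Qed.

Section draws.
Variables (S : T -> {set 'I_n}) (x1 : T -> 'I_n -> 'cV[R]_2).
Hypotheses (mS : forall s, measurable (S @^-1` [set s])) (mx : measurable_tuple x1)
  (hties : ties_from_block P A S x1) (Sk : forall w, #|S w| = k)
  (Px1 : forall w, Pi (S w) (x1 w)).

(* Here the deviation is O(sqrt (log n)), which leaves no room for a union bound
   over the values of x1: instead, given the draw, the entries outside the block
   still have their original law. *)
Lemma row_noise_event : exists B : set T,
  [/\ measurable B, (P B <= (n%:R ^- 2)%:E)%E &
    forall w, ~ B w -> forall i y z, i \notin S w -> grid k y -> grid k z ->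
      noise F A (row_coef (S w) i y z (x1 w)) w <= 4 * Num.sqrt (ln n%:R) *
        Num.sqrt (2 * \sum_i' \sum_j row_coef (S w) i y z (x1 w) i' j ^+ 2)].
Proof.
pose I := ({set 'I_n} * {ffun 'I_n -> 'I_n})%type.
pose J := ('I_n * ('I_n * 'I_n))%type.
pose t : R := 4 * Num.sqrt (ln n%:R).
have ln0 : 0 <= ln n%:R :> R by rewrite ln_ge0 // ler1n; lia.
have t0 : 0 <= t by rewrite mulr_ge0 // sqrtr_ge0.
pose C (p : I) (q : J) := row_coef p.1 q.1 (gridpt R k q.2.1) (gridpt R k q.2.2) (grid_tuple p.2).
have C0 (p : I) (q : J) i : C p q i i = 0.
  rewrite /C /row_coef; case: ifP => // /and3P[/eqP->]; by move=> /negbTE ->.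
have Cs (p : I) (q : J) i j : i \in p.1 -> j \in p.1 -> C p q i j = 0.
  by move=> ip jp; rewrite /C /row_coef; case: ifP => // /and3P[/eqP <-]; rewrite ip.
pose D (p : I) := draw S x1 p.1 (grid_tuple p.2).
have mD p : measurable (D p) by exact: measurable_draw.
pose Q (p : I) := code_on p.1 p.2 && (#|p.1| == k).
have e8 : - (t ^+ 2) / 2 = - (8%:R * ln n%:R).
  by rewrite /t exprMn sqr_sqrtr //; field.
pose e : R := (n%:R ^+ 8)^-1.
have inner p := @union_bound _ T R P J xpredT (fun q => D p `&` noise_exceeds F A (C p q) t)
  (fun q => (fine (P (D p)) * e)%:E).
have PDE p : P (D p) = (fine (P (D p)))%:E by rewrite fineK // fin_num_measure.
have mDN p q : measurable (D p `&` noise_exceeds F A (C p q) t).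
  by apply: measurableI => //; exact: measurable_noise_exceeds hA hA0 hE _ _.
have PDN p q : (P (D p `&` noise_exceeds F A (C p q) t) <= (fine (P (D p)) * e)%:E)%E.
  rewrite /D (draw_independent hA hA0 hE mS mx hties) //; last exact: Cs.
  rewrite EFinM -PDE lee_pmul //.
  apply: le_trans (noise_exceeds_le hF hA hA0 hE hG (C0 p q) t0) _.
  by rewrite e8 expRN_natM_ln.
pose X p := [set w | exists2 q : J, xpredT q & (D p `&` noise_exceeds F A (C p q) t) w].
have mX p : measurable (X p) by have [] := inner p (fun q _ => mDN p q) (fun q _ => PDN p q).
(* Given the draw, only the n^3 choices of a row and two grid points remain, each with tail
   n^(-8). *)
have PX p : (P (X p) <= (fine (P (D p)) * (n%:R ^+ 3 * e))%:E)%E.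
  have [_] := inner p (fun q _ => mDN p q) (fun q _ => PDN p q).
  move=> h; apply: le_trans h _; rewrite sumEFin lee_fin sumr_const.
  rewrite (_ : #|_| = #|{: J}|) // !card_prod !card_ord -[_ *+ _]mulr_natl !natrM.
  by rewrite le_eqVlt; apply/orP; left; apply/eqP; ring.
(* The draws are disjoint, so averaging over them, instead of a union bound, costs nothing. *)
have sumD : \sum_(p | Q p) fine (P (D p)) <= 1.
  rewrite -lee_fin -sumEFin -(@probability_setT _ _ _ P).
  under eq_bigr do rewrite -PDE.
  apply: measure_disjoint_sum_le => [p _|[s c] [s' c'] w]; first exact: mD.
  move=> /andP[/= /forallP cs _] /andP[/= /forallP cs' _] [/= Ss h] [/= Ss' h'].
  move: cs' h'; rewrite -Ss' Ss => cs' h'; congr pair.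
  apply/ffunP => i; have := cs i; have := cs' i; case: ifP => iS.
    move=> c'k ck; apply/val_inj; apply: (@gridpt_inj R k) => //.
    by have := h i iS; rewrite h'.
  by move=> /eqP-> /eqP->.
have [mB PB] := @union_bound _ T R P I Q X _ (fun p _ => mX p) (fun p _ => PX p).
exists [set w | exists2 p : I, Q p & X p w]; split => //.
- apply: le_trans PB _; rewrite sumEFin lee_fin -mulr_suml.
  have e0 : 0 <= n%:R ^+ 3 * e by rewrite mulr_ge0 ?invr_ge0 ?exprn_ge0.
  apply: le_trans (ler_wpM2r e0 sumD) _; rewrite mul1r /e.
  rewrite (_ : _ * _ = (n%:R ^+ 5)^-1); last by field; rewrite gt_eqF.
  rewrite lef_pV2 ?posrE ?exprn_gt0 //; apply: ler_weXn2l => //.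
  by rewrite ler1n; lia.
- move=> w nB i _ _ iS [a ak <-] [b bk <-].
  have [c cs xE] := Pi_code (Sk w) (Px1 w).
  have lt_n m : `I_k m -> (m < n)%N by move=> /= mk; rewrite nE; lia.
  rewrite leNgt; apply/negP => h; apply: nB; exists (S w, c); first by rewrite /Q cs Sk eqxx.
  exists (i, (Ordinal (lt_n a ak), Ordinal (lt_n b bk))) => //; split => //.
  rewrite /noise_exceeds /= (_ : C _ _ = row_coef (S w) i (gridpt R k a) (gridpt R k b) (x1 w)) //.
  apply/funext => i'; apply/funext => j; rewrite /C /row_coef /=.
  by case: ifP => // /and3P[_ _ jS]; rewrite !xE.
Qed.

Lemma balanced_event (sg : 'I_n -> nat) : (forall i, (sg i < n)%N) -> injective sg ->
  rate R n <= 1 / 2 ->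
  (forall s, #|s| = k -> (P (S @^-1` [set s]) <= ('C(n, k)%:R^-1)%:E)%E) ->
  exists B : set T, [/\ measurable B, (P B <= (n%:R ^- 2)%:E)%E &
    forall w, ~ B w -> ~~ unbalanced sg (10 * n%:R * rate R n) (S w)].
Proof.
move=> sgn sgI r2 PS.
pose Q s := (#|s| == k) && unbalanced sg (10 * n%:R * rate R n) s.
have [mB PB] := @union_bound _ T R P {set 'I_n} Q (fun s => S @^-1` [set s])
  (fun=> ('C(n, k)%:R^-1)%:E) (fun s _ => mS s) (fun s Qs => PS s (eqP (andP Qs).1)).
exists [set w | exists2 s, Q s & (S @^-1` [set s]) w]; split => //.
- apply: le_trans PB _; rewrite sumEFin lee_fin sumr_const -[_ *+ _]mulr_natl.
  have n1 : (1 < n)%N by [].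
  have := card_unbalanced n1 nE sgn sgI r2; rewrite cardsE.
  have C0 : 0 < 'C(n, k)%:R :> R by rewrite ltr0n bin_gt0 nE; lia.
  move=> h; rewrite ler_pdivrMr //; apply: le_trans h _.
  by rewrite mulrC.
- move=> w nB; apply/negP => h; apply: nB; exists (S w) => //.
  by rewrite /Q Sk eqxx.
Qed.

End draws.

(** The joint law is constant on disjoint pairs, a symmetric relation, so the second draw has the
    same marginal as the first. *)
Lemma uniform_draws_marginal (S S' : T -> {set 'I_n}) : uniform_draws P A k S S' ->
  (forall s, #|s| = k -> (P (S @^-1` [set s]) <= ('C(n, k)%:R^-1)%:E)%E) /\
  (forall s, #|s| = k -> (P (S' @^-1` [set s]) <= ('C(n, k)%:R^-1)%:E)%E).
Proof.
move=> [mS mS' SS' unif].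
pose c : R := 'C(n, k)%:R^-1 * 'C(n - k, k)%:R^-1.
have PSS' s s' : #|s| = k -> #|s'| = k -> s' \subset ~: s ->
    P (S @^-1` [set s] `&` S' @^-1` [set s']) = c%:E.
  move=> sk s'k sub.
  have := unif s s' (fun _ _ => setT) sk s'k sub (fun _ _ => measurableT).
  rewrite (_ : entries_in _ _ _ = setT); last by apply/seteqP; split.
  by rewrite setTI probability_setT mul1e.
have C0 : 'C(n - k, k)%:R != 0 :> R by rewrite pnatr_eq0 -lt0n bin_gt0 nE; lia.
have cnt s : #|s| = k -> #|[pred s' : {set 'I_n} | (s' \subset ~: s) && (#|s'| == k)]| = 'C(n - k, k).
  by move=> sk; rewrite -cardsE cards_draws cardsCs finset.setCK card_ord sk.
have tot s : #|s| = k -> \sum_(s' : {set 'I_n} | (s' \subset ~: s) && (#|s'| == k)) c = 'C(n, k)%:R^-1.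
  by move=> sk; rewrite sumr_const cnt // -[_ *+ _]mulr_natl /c mulrCA mulfV // mulr1.
split=> s sk.
- have b s' : (s' \subset ~: s) && (#|s'| == k) ->
      (P (S @^-1` [set s] `&` S' @^-1` [set s']) <= c%:E)%E.
    by move=> /andP[sub /eqP s'k]; rewrite PSS'.
  have [_ h] := union_bound (fun s' _ => measurableI _ _ (mS s) (mS' s')) b.
  rewrite -(tot s sk) -sumEFin; apply: le_trans h; rewrite le_eqVlt; apply/orP; left; apply/eqP.
  congr (P _); apply/seteqP; split => w /=; last by case=> s' _ [].
  by move=> Sw; have [_ S'k sub] := SS' w; exists (S' w); rewrite -?Sw ?sub ?S'k ?eqxx.
- have b s' : (s' \subset ~: s) && (#|s'| == k) ->
      (P (S @^-1` [set s'] `&` S' @^-1` [set s]) <= c%:E)%E.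
    move=> /andP[sub /eqP s'k]; rewrite PSS' //.
    by rewrite -finset.setCS finset.setCK.
  have [_ h] := union_bound (fun s' _ => measurableI _ _ (mS s') (mS' s)) b.
  rewrite -(tot s sk) -sumEFin; apply: le_trans h; rewrite le_eqVlt; apply/orP; left; apply/eqP.
  congr (P _); apply/seteqP; split => w /=; last by case=> s' _ [].
  move=> Sw; have [Sk _ sub] := SS' w; exists (S w) => //.
  by rewrite Sk eqxx andbT -Sw -finset.setCS finset.setCK.
Qed.

End events.

(** * Conclusion *)

(* Errors, relative to rho >= rate: on the entries of the Gram matrix on S, on the
   aligned points of S (on average), and on each point outside S. *)
Definition gram_const (R : realType) (cl cL ce : R) : R :=
  2 / cl * (2 * cL * 400 + 3 * ce + 24).

Definition align_const (R : realType) (cl cL ce : R) : R :=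
  1600 * gram_const cl cL ce + 400.

Definition local_const (R : realType) (cl cL ce : R) : R :=
  256 / cl * (3 * ce + cL * align_const cl cL ce + cL * 32 + 12) + 32.

Lemma gram_const_ge0 (R : realType) (cl cL ce : R) :
  0 < cl -> 0 <= cL -> 0 <= ce -> 0 <= gram_const cl cL ce.
Proof.
move=> cl0 cL0 ce0; apply: mulr_ge0.
  by apply: divr_ge0; [exact: ler0n|exact: ltW].
apply: addr_ge0; last exact: ler0n.
apply: addr_ge0; apply: mulr_ge0; rewrite ?ler0n //.
by apply: mulr_ge0; [exact: ler0n|].
Qed.

Lemma local_const_ge0 (R : realType) (cl cL ce : R) :
  0 < cl -> 0 <= cL -> 0 <= ce -> 0 <= local_const cl cL ce.
Proof.
move=> cl0 cL0 ce0; have a0 := gram_const_ge0 cl0 cL0 ce0.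
apply: addr_ge0; last exact: ler0n.
apply: mulr_ge0; first by apply: divr_ge0; [exact: ler0n|exact: ltW].
apply: addr_ge0; last exact: ler0n.
apply: addr_ge0; last by apply: mulr_ge0; [|exact: ler0n].
apply: addr_ge0; first by apply: mulr_ge0; [exact: ler0n|].
apply: mulr_ge0; first by [].
by apply: addr_ge0; [apply: mulr_ge0; [exact: ler0n|]|exact: ler0n].
Qed.

Lemma pi_le4 (R : realType) : pi <= 4 :> R.
Proof. by have := pihalf_lt2 R; lra. Qed.

Lemma ln_ge1 (R : realType) m : (4 <= m)%N -> 1 <= ln m%:R :> R.
Proof.
move=> m4; have mp : 0 < m%:R :> R by rewrite ltr0n; lia.
rewrite -ler_expR lnK ?posrE //; apply: le_trans (_ : 4 <= _); last by rewrite (ler_nat R 4).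
have := @expR_le_quad R (1 / 2) (lexx _) => h.
have -> : 1 = 1 / 2 + 1 / 2 :> R by field.
rewrite expRD; have := expR_gt0 (1 / 2 : R); nra.
Qed.

Section localization.
Variables (R : realType) (n k : nat) (cl cL ce rho : R).
Hypotheses (nE : n = (4 * k)%N) (k2 : (2 < k)%N).

Let n4 : (4 <= n)%N. Proof. by rewrite nE; lia. Qed.

Let k0 : 0 < k%:R :> R. Proof. by rewrite ltr0n; lia. Qed.

Let r := rate R n.

Hypothesis r1 : r <= 1.

(** From ln n >= 1 and r <= 1 follows 1 <= n r^2 <= n r. Rounding to a grid therefore costs no more
    than the rate. *)
Lemma inv_n_le_rate : 1 / n%:R <= r.
Proof.
have n0 : 0 < n%:R :> R by rewrite ltr0n nE; lia.
have := rate_sqr R nE (ltnW (ltnW k2)); rewrite -/r => h.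
have h1 : 1 <= n%:R * r ^+ 2 by rewrite h; exact: ln_ge1 n4.
rewrite ler_pdivrMr //; apply: le_trans h1 _.
rewrite mulrC ler_pM2r // expr2 ler_piMr // ; exact: rate_ge0.
Qed.

Hypothesis rrho : r <= rho.

Lemma grid_step_le : 2 * pi / k%:R <= 32 * rho.
Proof.
have := inv_n_le_rate; rewrite nE natrM => h.
rewrite (_ : 2 * pi / k%:R = 8 * pi * (1 / (4 * k%:R))); last by field; rewrite gt_eqF.
have i0 : 0 <= 1 / (4 * k%:R) :> R by rewrite divr_ge0 // mulr_ge0 // ltW.
have p4 := pi_le4 R.
apply: le_trans (_ : 32 * (1 / (4 * k%:R)) <= _); first by rewrite ler_wpM2r //; lra.
by move: rrho; lra.
Qed.

Hypotheses (ce0 : 0 <= ce) (cl0 : 0 < cl) (cL0 : 0 <= cL).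

Local Notation a1 := (gram_const cl cL ce).
Local Notation a2 := (align_const cl cL ce).
Local Notation a3 := (local_const cl cL ce).

Hypothesis small : a1 * rho <= 1 / 48.

Lemma localize_error (S : {set 'I_n}) (xs z v x2 : 'I_n -> 'cV[R]_2) f (F : 'M[R]_n)
    (disp : measure_display) (T : measurableType disp) (A : T -> 'M[R]_n) w :
  #|S| = k -> BL n cl cL ce f -> (forall i, circle (xs i)) ->
  (forall i j, i != j -> F i j = f (xs i) (xs j)) ->
  Pi S z -> {in S, forall i, d (xs i) (z i) <= 400 * rho} ->
  argmin (@Pi R n S)
    (fun x => \sum_(i in S) \sum_(j in S) A w i j * d (x i) (x j)) v ->
  (forall i, i \notin S -> argmin (@grid R k)
     (fun y => \sum_(j in S) A w i j * d y (v j)) (x2 i)) ->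
  (forall u v', Pi S u -> Pi S v' ->
    noise F A (block_coef S u v') w <= 4 * n%:R * r *
      Num.sqrt (2 * \sum_i \sum_j block_coef S u v' i j ^+ 2)) ->
  (forall i y y', i \notin S -> grid k y -> grid k y' ->
    noise F A (row_coef S i y y' v) w <= 4 * Num.sqrt (ln n%:R) *
      Num.sqrt (2 * \sum_i' \sum_j row_coef S i y y' v i' j ^+ 2)) ->
  exists2 U, orthogonal_group U & forall i, i \notin S -> d (x2 i) (U *m xs i) <= a3 * rho.
Proof.
move=> Sk fBL cx FE Pz hz [Pv vmin] x2min blk row.
have r0 : 0 <= r by exact: rate_ge0.
have rho0 : 0 <= rho by exact: le_trans rrho.
have nR : n%:R = 4 * k%:R :> R by rewrite nE natrM.
have S2 : (2 < #|S|)%N by rewrite Sk.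
have ln0 : 0 <= ln n%:R :> R by apply: le_trans (ln_ge1 R n4).
have eta0 : 0 <= 400 * rho by apply: mulr_ge0; first exact: ler0n.
have tau0 : 0 <= 24 * r by rewrite mulr_ge0.
have tau0' : 0 <= 12 * r by rewrite mulr_ge0.
have nblk : \sum_(i in S) \sum_(j in S) (A w i j - F i j) * (d (z i) (z j) - d (v i) (v j)) <=
    24 * r * #|S|%:R * Num.sqrt (\sum_(i in S) \sum_(j in S) (d (z i) (z j) - d (v i) (v j)) ^+ 2).
  (* The constant 24 is 16 * 3/2: n = 4k in the bound 4 n r, and sqrt 2 <= 3/2. *)
  have := blk z v Pz Pv; rewrite noise_block sqr_block sqrtrM // Sk nR => h.
  apply: le_trans h _; set q := Num.sqrt (\sum_(i in S) _).
  have q0 : 0 <= q by exact: sqrtr_ge0.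
  have s2 : Num.sqrt 2 <= 3 / 2 :> R.
    rewrite -(@ler_pXn2r _ 2) // ?nnegrE ?sqrtr_ge0 ?sqr_sqrtr //; lra.
  rewrite (_ : 4 * (4 * k%:R) * r * (Num.sqrt 2 * q) = Num.sqrt 2 * (16 * (k%:R * r * q))); last by ring.
  rewrite (_ : 24 * r * k%:R * q = 3 / 2 * (16 * (k%:R * r * q))); last by field.
  by rewrite ler_wpM2r // !mulr_ge0 // ltW.
have d1le : 2 / cl * (2 * cL * (400 * rho) + 3 * (ce * rate R n) + 24 * r) <= a1 * rho.
  rewrite /gram_const -[leRHS]mulrA ler_wpM2l ?divr_ge0 ?(ltW cl0) // -/r.
  have := ler_wpM2l ce0 rrho; move: rrho; lra.
have [U oU hU] := stage1 ce0 cl0 cL0 S2 eta0 tau0 fBL Pz Pv (fun i _ => cx i) hz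
  (fun i j _ _ ij => FE i j ij) (vmin _ Pz) nblk (le_trans d1le small).
exists U => // i iS.
have kap : \sum_(j in S) d (v j) (U *m xs j) <= #|S|%:R * (a2 * rho).
  by apply: le_trans hU _; rewrite ler_wpM2l // /align_const; move: d1le; lra.
have FE' : {in S, forall j, F i j = f (xs i) (xs j)}.
  by move=> j jS; apply: FE; apply/eqP => ij; move: iS; rewrite ij jS.
have zmin : argmin (@grid R #|S|) (fun y => \sum_(j in S) A w i j * d y (v j)) (x2 i).
  by rewrite Sk; exact: x2min.
have gx2 : grid k (x2 i) by case: (x2min i iS).
have nrow y : grid #|S| y ->
    \sum_(j in S) (A w i j - F i j) * (d y (v j) - d (x2 i) (v j)) <= 12 * r * #|S|%:R * d y (x2 i).
  rewrite Sk => gy; have := row i y (x2 i) iS gy gx2; rewrite noise_row // sqr_row // => hn.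
  apply: le_trans hn _.
  have cy := circle_grid gy; have c2 := circle_grid gx2.
  have /andP[h0 _] := d_itv cy c2; set h := d y (x2 i) in h0 *.
  set q := \sum_(j in S) _.
  rewrite -[leLHS]mulrA -(sqrtrM (2 * q) ln0).
  have -> : 12 * r * k%:R * h = 4 * (3 * r * k%:R * h) by ring.
  rewrite ler_wpM2l //.
  have q0 : 0 <= 3 * r * k%:R * h by rewrite !mulr_ge0 // ltW.
  rewrite -[leRHS]ger0_norm // -sqrtr_sqr ler_wsqrtr //.
  have sm : q <= k%:R * h ^+ 2.
    rewrite /q -Sk mulr_natl -sumr_const; apply: ler_sum => j jS.
    rewrite -[leLHS]real_normK ?num_real // lerXn2r // ?nnegrE //.
    by apply: normB_d_le => //; exact: circle_Pi Pv jS.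
  (* With ln n = 4 k r^2 and q <= k h^2, the product under the root is at most 8 (r k h)^2 <= (3 r k
     h)^2; hence 12 = 4 * 3. *)
  rewrite -(rate_sqr R nE (ltnW (ltnW k2))) -/r nR.
  apply: le_trans (_ : 4 * k%:R * r ^+ 2 * (2 * (k%:R * h ^+ 2)) <= _).
    by rewrite ler_wpM2l ?mulr_ge0 ?sqr_ge0 ?(ltW k0) // ler_wpM2l.
  rewrite -subr_ge0 (_ : _ - _ = (r * k%:R * h) ^+ 2) ?sqr_ge0 //.
  by ring.
apply: le_trans (stage2 ce0 cl0 cL0 S2 fBL Pv oU cx kap FE' tau0' zmin nrow) _.
have gs := grid_step_le; rewrite Sk -/r.
have -> : a3 * rho = 256 / cl * ((3 * ce + cL * a2 + cL * 32 + 12) * rho) + 32 * rho.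
  by rewrite /local_const; ring.
apply: lerD => //.
apply: ler_wpM2l; first by apply: divr_ge0; [exact: ler0n|exact: ltW].
have := ler_wpM2l ce0 rrho; have := ler_wpM2l cL0 gs; move: rrho; lra.
Qed.

End localization.

Lemma d_le_pi (R : realType) (x y : 'cV[R]_2) : d x y <= pi.
Proof.
rewrite /d; move: `|_| => u.
by case: (leP u) => h; lra.
Qed.

(** Moving the points by [V] and transporting [f] accordingly leaves [F] unchanged, and an isometry
    preserving the grid tuples does not increase the distance to them, so minimality survives. *)
Lemma RepsPi_ortho (R : realType) (n : nat) (cl cL ce m : R) (F : 'M[R]_n) xs f V :
  is_min [set dPi xf.1 | xf in Reps F cl cL ce] m ->
  Reps F cl cL ce (xs, f) -> dPi xs = m -> orthogonal_group V ->
  (forall y : 'I_n -> 'cV[R]_2, Pi [set: 'I_n] y -> Pi [set: 'I_n] (fun i => V *m y i)) ->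
  RepsPi F cl cL ce (fun i => V *m xs i, fun a b => f (V^T *m a) (V^T *m b)).
Proof.
move=> [_ mmin] [cx fBL FE] xm oV PV; split => /=.
  split => /=; first by move=> i; apply: circle_ortho => //; exact: cx.
    exact/BL_ortho/fBL/ortho_trmx.
  by move=> i j ij; rewrite !ortho_Ktr //; exact: FE.
move=> [y g] Ry /=; apply: le_trans (_ : m <= _); last by apply: mmin; exists (y, g).
by rewrite -xm; exact: dPi_ortho_le.
Qed.

Theorem theorem3p1 (R : realType) (ce cl cL : R)
    (hce : 0 <= ce) (hcl : 0 < cl) (hcL : cl <= cL) :
  exists C : R, 0 < C /\
  forall (n : nat) (hn : (0 < n)%N) (hn4 : (4 %| n)%N)
    (disp : measure_display) (T : measurableType disp) (P : probability T R)
    (xs : 'I_n -> 'cV[R]_2) (fs : 'cV[R]_2 -> 'cV[R]_2 -> R)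
    (F : 'M[R]_n) (E : 'I_n -> 'I_n -> {RV P >-> R}) (A : T -> 'M[R]_n)
    (xhat : T -> 'I_n -> 'cV[R]_2)
    (hxs : forall i, circle (xs i))
    (hfs : BL n cl cL ce fs)
    (hFsym : F^T = F)
    (hF : forall i j : 'I_n, (i < j)%N -> F i j = fs (xs i) (xs j))
    (hAsym : forall w, (A w)^T = A w)
    (hAdiag : forall w i, A w i i = 0)
    (hA : forall w (i j : 'I_n), (i < j)%N -> A w i j = F i j + E i j w)
    (hEcentered : forall i j : 'I_n, (i < j)%N -> ('E_P[E i j] = 0)%E)
    (hEindep : mutually_independent P
       [pred p : 'I_n * 'I_n | (p.1 < p.2)%N] (fun p => E p.1 p.2))
    (hEsubG : subGaussian1 P (fun i j => E i j))
    (hxhat : localize_and_refine P A xhat)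
    (m : R)
    (hm : is_min [set dPi xf.1 | xf in Reps F cl cL ce] m),
  exists G : set T,
    [/\ measurable G,
        ((1 - 5 / n%:R ^+ 2)%:E <= P G)%E &
        forall w, G w -> exists2 xf, RepsPi F cl cL ce xf &
          dinf [set: 'I_n] (xhat w) xf.1 <= C * (m + rate R n)].
Proof.
have cL0 : 0 <= cL by apply: le_trans hcL; exact: ltW.
set a1 := gram_const cl cL ce; set a3 := local_const cl cL ce.
have a10 : 0 <= a1 by exact: gram_const_ge0.
have a30 : 0 <= a3 by exact: local_const_ge0.
(* 65 a3 bounds the refined estimate and 8 the rounding to an isometry of the n-gon. The last
   summand turns C rho < 4 into a1 rho <= 1/48, for the alignment, and 400 rho <= 1/24, for
   isotropy. *)
pose C := 65 * a3 + 8 + 4 * (48 * a1 + (96 * 100)).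
have C0 : 0 < C by rewrite /C; lra.
exists C; split => // n hn hn4 disp T P _ _ F E A xhat _ _ hFsym _ hAsym hA0 hA _ _ hG hloc m hm.
have [[[xs f] Rxs xm] mmin] := hm.
have [/= cx fBL FE] := Rxs; move: xm => /= xm.
pose k := (n %/ 4)%N.
have nE : n = (4 * k)%N by rewrite /k mulnC divnK.
have k1 : (0 < k)%N by rewrite divn_gt0 // dvdn_leq.
have n4 : (4 <= n)%N by exact: dvdn_leq.
have m0 : 0 <= m by rewrite -xm; exact: dPi_ge0.
have r0 : 0 <= rate R n by exact: rate_ge0.
set rho := m + rate R n.
have rho0 : 0 <= rho by exact: addr_ge0.
case: (leP 4 (C * rho)) => [big|Crho].
  exists setT; split => //.
    by rewrite probability_setT lee_fin gerBl divr_ge0 // exprn_ge0.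
  move=> w _; exists (xs, f).
    by split => // -[y g] Ry /=; rewrite xm; apply: mmin; exists (y, g).
  apply: le_trans big; apply: dinf_le => // i _.
  by apply: le_trans (d_le_pi _ _) _; exact: pi_le4.
have r_rho : rate R n <= rho by rewrite /rho lerDr.
have small : (48 * a1 + (96 * 100)) * rho <= 1.
  have : 0 <= (65 * a3 + 8) * rho by rewrite mulr_ge0 // addr_ge0 // mulr_ge0.
  by move: Crho; rewrite /C; lra.
have small1 : a1 * rho <= 1 / 48.
  by move: small rho0; rewrite mulrDl -mulrA; lra.
have small2 : rho <= 1 / (96 * 100).
  by move: small; have := mulr_ge0 a10 rho0; lra.
have e24 : 400 * rho <= 1 / 24 by lra.
have r4 : rate R n <= 1 / 4 by lra.
clear small small2 Crho.
(* Isotropy needs at least three grid points. If k <= 2, then ln n = n r^2 <= 8 / 16, contradicting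
   ln n >= 1. *)
have k2 : (2 < k)%N.
  rewrite ltnNge; apply/negP => k3.
  have n8 : n%:R <= 8 :> R by rewrite ler_nat nE (leq_mul2l 4 k 2).
  have : n%:R * rate R n ^+ 2 <= 8 * (1 / 4) ^+ 2.
    apply: ler_pM => //; first by exact: sqr_ge0.
    by apply: lerXn2r; rewrite ?nnegrE //; lra.
  rewrite (rate_sqr R nE k1); have := ln_ge1 R n4; lra.
have r1 : rate R n <= 1 by lra.
have r2 : rate R n <= 1 / 2 by lra.
have FEn i j : i != j -> F i j = f (xs i) (xs j).
  move=> ij; case: (ltngtP i j) => [h|h|/val_inj h]; [by rewrite FE| |by rewrite h eqxx in ij].
  have [fsym _ _ _] := fBL.
  by rewrite (F_sym hFsym) -FE // fsym.
have [S [S' [x1 [x2 [x1' [x2' [Qh [unif [loc loc'] mQ Qmin xhatE]]]]]]]] := hloc.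
rewrite -/k in unif loc loc'.
have [margS margS'] := uniform_draws_marginal nE k1 unif.
have [mS mS' SS' _] := unif.
have Sk w : #|S w| = k by case: (SS' w).
have S'k w : #|S' w| = k by case: (SS' w).
have [mx1 mx2 ties1 min1 min2] := loc.
have [mx1' mx2' ties1' min1' min2'] := loc'.
have rpos : 0 < rate R n.
  by apply: lt_le_trans (inv_n_le_rate nE k2 r1); rewrite divr_gt0 // ltr0n.
(* With the rate as slack, [y] is within m + rate = rho of [xs]; its indices [sg] order the points
   along the circle, and balance is measured in this order. *)
have [y Py hy] := dPi_near xs rpos.
rewrite xm -/rho in hy.
have [sg [sgn sgI yE]] := Py.
rewrite cardsT card_ord in sgn yE.
have sgn' i : (sg i < n)%N by apply: sgn; rewrite inE.
have sgI' : injective sg by move=> i j; apply: sgI; rewrite inE.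
have yE' i : y i = gridpt R n (sg i) by apply: yE; rewrite inE.
have [B1 [mB1 PB1 hB1]] := block_noise_event nE k1 hFsym hAsym hA0 hA hG.
have [B2 [mB2 PB2 hB2]] := row_noise_event nE k1 hFsym hAsym hA0 hA hG mS mx1 ties1 Sk
  (fun w => (min1 w).1).
have [B3 [mB3 PB3 hB3]] := row_noise_event nE k1 hFsym hAsym hA0 hA hG mS' mx1' ties1' S'k
  (fun w => (min1' w).1).
have [B4 [mB4 PB4 hB4]] := balanced_event nE k1 mS Sk sgn' sgI' r2 margS.
have [B5 [mB5 PB5 hB5]] := balanced_event nE k1 mS' S'k sgn' sgI' r2 margS'.
pose B := B1 `|` B2 `|` B3 `|` B4 `|` B5.
have mB : measurable B by rewrite /B; do !apply: measurableU => //.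
exists (~` B); split; first exact: measurableC.
  rewrite probability_setC // EFinB leeB //.
  have -> : 5 / n%:R ^+ 2 = n%:R ^- 2 + n%:R ^- 2 + n%:R ^- 2 + n%:R ^- 2 + n%:R ^- 2 :> R.
    by ring.
  rewrite !EFinD /B.
  have U2 X Y (a b : \bar R) : measurable X -> measurable Y ->
      (P X <= a)%E -> (P Y <= b)%E -> (P (X `|` Y) <= a + b)%E.
    by move=> mX mY Xa Yb; apply: le_trans (measureU2 _ mX mY) _; exact: leeD.
  have m12 := measurableU _ _ mB1 mB2; have m123 := measurableU _ _ m12 mB3.
  have m1234 := measurableU _ _ m123 mB4.
  exact: U2 m1234 mB5 (U2 _ _ _ _ m123 mB4 (U2 _ _ _ _ m12 mB3 (U2 _ _ _ _ mB1 mB2 PB1 PB2)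
    PB3) PB4) PB5.
move=> w; rewrite /B /= => nB.
have {}hB1 := hB1 w (fun h => nB (or_introl (or_introl (or_introl (or_introl h))))).
have {}hB2 := hB2 w (fun h => nB (or_introl (or_introl (or_introl (or_intror h))))).
have {}hB3 := hB3 w (fun h => nB (or_introl (or_introl (or_intror h)))).
have {}hB4 := hB4 w (fun h => nB (or_introl (or_intror h))).
have {}hB5 := hB5 w (fun h => nB (or_intror h)).
have grid_of (s : {set 'I_n}) : #|s| = k -> ~~ unbalanced sg (10 * n%:R * rate R n) s ->
    exists2 z, Pi s z & {in s, forall i, d (xs i) (z i) <= 400 * rho}.
  move=> sk bal.
  have s0 : (0 < #|s|)%N by rewrite sk.
  have snE : n = (4 * #|s|)%N by rewrite sk.
  have disc t : (t <= n)%N ->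
      `|#|[set i in s | (sg i < t)%N]%SET|%:R - t%:R / 4| <= 10 * n%:R * rate R n.
    move=> tn; rewrite leNgt; apply: contra bal => h; apply/existsP.
    exists (Ordinal (tn : (t < n.+1)%N)); rewrite /= (_ : s :&: _ = [set i in s | (sg i < t)%N]%SET) //.
    by apply/setP => i; rewrite !inE.
  have [z Pz hz] := Pi_of_discrepancy s0 snE sgn' sgI' yE' disc.
  exists z => // i iS.
  apply: le_trans (d_triangle (cx i) (circle_Pi Py (finset.in_setT i)) (circle_Pi Pz iS)) _.
  apply: le_trans (lerD (hy i) (hz i iS)) _.
  have kp : 0 < k%:R :> R by rewrite ltr0n.
  have -> : 2 * pi / #|s|%:R * (10 * n%:R * rate R n) = 80 * pi * rate R n.
    have -> : n%:R = 4 * k%:R :> R by rewrite {1}nE natrM.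
    by rewrite sk; field; rewrite gt_eqF.
  (* The total is at most rho + 80 * 4 rho = 321 rho, rounded up to 400 rho. *)
  have : pi * rate R n <= 4 * rho by apply: ler_pM => //; [exact: pi_ge0|exact: pi_le4].
  by move: rho0; lra.
have [z Pz hz] := grid_of _ (Sk w) hB4.
have [z' Pz' hz'] := grid_of _ (S'k w) hB5.
have [U oU hU] := localize_error nE k2 r1 r_rho hce hcl cL0 small1 (Sk w) fBL cx FEn Pz hz
  (min1 w) (min2 w) (fun u v => hB1 (S w) u v (Sk w)) hB2.
have [U' oU' hU'] := localize_error nE k2 r1 r_rho hce hcl cL0 small1 (S'k w) fBL cx FEn Pz' hz'
  (min1' w) (min2' w) (fun u v => hB1 (S' w) u v (S'k w)) hB3.
have c2 i : i \notin S w -> circle (x2 w i) by move=> /(min2 w)[gz _]; exact: circle_grid gz.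
have c2' i : i \notin S' w -> circle (x2' w i) by move=> /(min2' w)[gz _]; exact: circle_grid gz.
(* [U] alone could destroy minimality among representations; its rounding [V] does not. *)
have [V [oV UV PV]] := near_dihedral hn oU.
exists (fun i => V *m xs i, fun a b => f (V^T *m a) (V^T *m b)).
  exact: RepsPi_ortho hm Rxs xm oV PV.
apply: dinf_le => /= [|j _]; first by rewrite mulr_ge0 // ltW.
have [_ _ sub] := SS' w.
have cxh : circle (xhat w j).
  rewrite xhatE; case: ifPn => jS; last exact: c2.
  apply: circle_ortho; first by case: (Qmin w).
  by apply: c2'; apply/negP => /(fintype.subsetP sub); rewrite inE jS.
have S2 : (2 < #|S w|)%N by rewrite Sk.
have SSk : #|S' w| = #|S w| by rewrite Sk S'k.
have nES : n = (4 * #|S w|)%N by rewrite Sk.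
have hy' i : d (xs i) (y i) <= 400 * rho by apply: le_trans (hy i) _; lra.
have kap0 : 0 <= a3 * rho by exact: mulr_ge0.
have := refine S2 SSk nES sub cx Py hy' Pz hz Pz' hz' e24 oU oU' kap0 c2 c2' hU hU' (Qmin w) j.
rewrite -xhatE => h65.
apply: le_trans (d_triangle cxh (circle_ortho oU (cx j)) (circle_ortho oV (cx j))) _.
have hUV : d (U *m xs j) (V *m xs j) <= 8 * rho.
  apply: le_trans (UV _ (cx j)) _.
  have := inv_n_le_rate nE k2 r1; have p4 := pi_le4 R.
  have i0 : 0 <= 1 / n%:R :> R by rewrite divr_ge0.
  have := ler_wpM2r i0 p4; lra.
have := mulr_ge0 a10 rho0.
by rewrite /C; lra.
Qed.
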